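(* For any nonempty set $X$, $\mathbf{R}(Free_{MV}(X))\simeq Free_{RMV}(X)$ as Riesz MV-algebras. Therefore the free MV-algebra generated by $X$ is essentially embedded in the free Riesz MV-algebra generated by $X$; moreover, the embedding can be chosen to be an inclusion (i.e. the two free algebras can be realized so that $Free_{MV}(X)$ is an MV-subalgebra of $Free_{RMV}(X)$ and the inclusion is essential).
   Context: An MV-algebra is a structure $(A,\oplus,{}^*,0)$ such that $(A,\oplus,0)$ is an abelian monoid, $(a^* )^*=a$, $0^*\oplus a=0^*$ and $(a^*\oplus b)^*\oplus b=(b^*\oplus a)^*\oplus a$. Put $1=0^*$, $a\odot b=(a^*\oplus b^* )^*$; $a\le b$ iff $a\odot b^*=0$. For $n\in\mathbb N$, $na=a\oplus\cdots\oplus a$ ($n$ times), $0a=0$. $A$ is semisimple if the intersection of its maximal ideals is $\{0\}$ (ideal: nonempty downward closed subset closed under $\oplus$). An MV-embedding is an injective MV-homomorphism. An embedding $\iota:A\to B$ is essential if for every $b>0$ in $B$ there are $a>0$ in $A$ and $n\in\mathbb N$ with $\iota(a)\le nb$. A Riesz MV-algebra is an MV-algebra $V$ with a map $\cdot:[0,1]\times V\to V$ such that $r(a\odot b^* )=(ra)\odot(rb)^*$, $\max(r-q,0)\,a=(ra)\odot(qa)^*$, $(rq)a=r(qa)$, $1a=a$ for all $r,q\in[0,1]$, $a,b\in V$. MV-homomorphisms between Riesz MV-algebras automatically preserve scalar multiplication. $Free_{MV}(X)$ and $Free_{RMV}(X)$ denote the free MV-algebra and the free Riesz MV-algebra over $X$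 (both classes are varieties, each generated by the real interval $[0,1]$ with $x\oplus y=\min(1,x+y)$, $x^*=1-x$, and real multiplication as scalar multiplication). $Free_{MV}(X)$ is semisimple. Riesz hull $\mathbf R(A)$ of a semisimple MV-algebra $A$: for an abelian lattice-ordered group $G$ with strong unit $u$, $\Gamma(G,u)$ is the MV-algebra $[0,u]$ with $x\oplus y=(x+y)\wedge u$, $x^*=u-x$; every MV-algebra is of this form up to isomorphism. If $A=\Gamma(G,u)$, its divisible hull is $A_d=\Gamma(G_d,u)$, where $G_d=\{g/n\mid g\in G,\ n\ge1\}$ is the divisible hull of $G$. The Dedekind-MacNeille completion $\hat B$ of a semisimple MV-algebra $B$ is the (unique up to isomorphism) MV-algebra containing $B$ as a subalgebra, complete as a lattice, in which every element is a supremum of elements of $B$. The completion $\widehat{A_d}$ carries a (unique) Riesz MV-algebra structure, and $\mathbf R(A)$ is the Riesz MV-subalgebra of $\widehat{A_d}$ generated by the image of $A$. *)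

(* Defs.v *)
From HB Require Import structures.
From mathcomp Require Import all_boot all_order all_algebra.
From mathcomp Require Import boolp classical_sets reals interval_inference.

Set Implicit Arguments.
Unset Strict Implicit.
Unset Printing Implicit Defensive.

Import Order.TTheory GRing.Theory Num.Theory.

Local Open Scope classical_set_scope.
Local Open Scope ring_scope.

(* The abelian monoid (A, oplus, 0) is the underlying nmodType, so that
   a oplus b is a + b and the n-fold sum n a is a *+ n. *)
HB.mixin Record isMVAlgebra A of GRing.Nmodule A := {
  star : A -> A;
  starK : forall a, star (star a) = a;
  star0D : forall a : A, star 0 + a = star 0;
  starDC : forall a b : A, star (star a + b) + b = star (star b + a) + a
}.

#[short(type="mvType")]
HB.structure Definition MVAlgebra := {A of GRing.Nmodule A & isMVAlgebra A}.

Section MVTheory.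
Variable A : mvType.
Implicit Types (a b : A) (S I J : set A).

Definition odot a b : A := star (star a + star b).
Definition mv_le a b : Prop := odot a (star b) = 0.
Definition mv_lt a b : Prop := mv_le a b /\ a <> b.

Definition mv_is_sup S a : Prop :=
  (forall s, S s -> mv_le s a) /\
  (forall b, (forall s, S s -> mv_le s b) -> mv_le a b).

Definition mv_is_inf S a : Prop :=
  (forall s, S s -> mv_le a s) /\
  (forall b, (forall s, S s -> mv_le b s) -> mv_le b a).

Definition mv_complete : Prop :=
  forall S, (exists a, mv_is_sup S a) /\ (exists a, mv_is_inf S a).

Definition mv_ideal I : Prop :=
  [/\ I !=set0, forall a b, mv_le a b -> I b -> I a
    & forall a b, I a -> I b -> I (a + b)].

Definition mv_maximal_ideal I : Prop :=
  [/\ mv_ideal I, I <> setT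
    & forall J, mv_ideal J -> J <> setT -> I `<=` J -> J = I].

Definition mv_semisimple : Prop :=
  \bigcap_(I in mv_maximal_ideal) I = [set 0].

End MVTheory.

Definition mv_hom (A B : mvType) (f : A -> B) : Prop :=
  [/\ f 0 = 0, {morph f : a b / a + b} & {morph f : a / star a}].

Definition mv_embedding (A B : mvType) (f : A -> B) : Prop :=
  mv_hom f /\ injective f.

Definition mv_iso (A B : mvType) (f : A -> B) : Prop :=
  mv_hom f /\ bijective f.

Definition mv_essential (A B : mvType) (f : A -> B) : Prop :=
  mv_embedding f /\
  forall b : B, mv_lt 0 b ->
    exists (a : A) (n : nat), mv_lt 0 a /\ mv_le (f a) (b *+ n).

Record mvSub (A : mvType) := MVSub {
  mvsub_set :> set A;
  mvsub0 : mvsub_set 0;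
  mvsubD : forall a b, mvsub_set a -> mvsub_set b -> mvsub_set (a + b);
  mvsub_star : forall a, mvsub_set a -> mvsub_set (star a)
}.

Section MVSubTheory.
Variables (A : mvType) (S : mvSub A).

Definition mvsub_sort : Type := set_type S.
HB.instance Definition _ := SubChoice.on mvsub_sort.

Definition mvsub_mk (a : A) (Sa : mvsub_set S a) : mvsub_sort := exist _ a (mem_set Sa).

Lemma mvsub_valP (x : mvsub_sort) : mvsub_set S (\val x).
Proof. exact: set_mem (valP x). Qed.

Definition mvsub_zero : mvsub_sort := mvsub_mk (mvsub0 S).
Definition mvsub_add (x y : mvsub_sort) : mvsub_sort :=
  mvsub_mk (mvsubD (mvsub_valP x) (mvsub_valP y)).
Definition mvsub_neg (x : mvsub_sort) : mvsub_sort :=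
  mvsub_mk (mvsub_star (mvsub_valP x)).

Lemma mvsub_addA : associative mvsub_add.
Proof. by move=> x y z; apply: val_inj; rewrite /= addrA. Qed.
Lemma mvsub_addC : commutative mvsub_add.
Proof. by move=> x y; apply: val_inj; rewrite /= addrC. Qed.
Lemma mvsub_add0 : left_id mvsub_zero mvsub_add.
Proof. by move=> x; apply: val_inj; rewrite /= add0r. Qed.

HB.instance Definition _ :=
  GRing.isNmodule.Build mvsub_sort mvsub_addA mvsub_addC mvsub_add0.

Lemma mvsub_negK x : mvsub_neg (mvsub_neg x) = x.
Proof. by apply: val_inj; rewrite /= starK. Qed.
Lemma mvsub_neg0D (x : mvsub_sort) : mvsub_neg 0 + x = mvsub_neg 0.
Proof. by apply: val_inj; rewrite /= star0D. Qed.
Lemma mvsub_negDC (x y : mvsub_sort) :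
  mvsub_neg (mvsub_neg x + y) + y = mvsub_neg (mvsub_neg y + x) + x.
Proof. by apply: val_inj; rewrite /= starDC. Qed.

HB.instance Definition _ :=
  isMVAlgebra.Build mvsub_sort mvsub_negK mvsub_neg0D mvsub_negDC.

End MVSubTheory.

HB.mixin Record MVAlgebra_isRiesz (R : realType) V of MVAlgebra V := {
  scal : {i01 R} -> V -> V;
  scal_odot : forall (r : {i01 R}) (a b : V),
    scal r (odot a (star b)) = odot (scal r a) (star (scal r b));
  scal_sub : forall (r q : {i01 R}) (a : V),
    scal (Num.max (r%:num - q%:num) 0)%:i01 a
      = odot (scal r a) (star (scal q a));
  scalM : forall (r q : {i01 R}) (a : V),
    scal (r%:num * q%:num)%:i01 a = scal r (scal q a);
  scal1 : forall a : V, scal 1%:i01 a = a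
}.

#[short(type="rieszMVType")]
HB.structure Definition RieszMV (R : realType) :=
  {V of MVAlgebra V & MVAlgebra_isRiesz R V}.

Definition riesz_hom (R : realType) (V W : rieszMVType R) (f : V -> W) : Prop :=
  mv_hom f /\ forall (r : {i01 R}) (a : V), f (scal r a) = scal r (f a).

Definition riesz_isomorphic (R : realType) (V W : rieszMVType R) : Prop :=
  exists f : V -> W, riesz_hom f /\ bijective f.

Record rieszSub (R : realType) (V : rieszMVType R) := RieszSub {
  rsub_mv :> mvSub V;
  rsub_scal : forall (r : {i01 R}) (a : V), mvsub_set rsub_mv a -> mvsub_set rsub_mv (scal r a)
}.

Section RieszSubTheory.
Variables (R : realType) (V : rieszMVType R) (S : rieszSub V).

Definition rsub_sort : Type := mvsub_sort S.
HB.instance Definition _ := SubChoice.on rsub_sort.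
HB.instance Definition _ := MVAlgebra.on rsub_sort.

Definition rsub_scale (r : {i01 R}) (x : rsub_sort) : rsub_sort :=
  mvsub_mk (rsub_scal r (mvsub_valP x)).

Lemma rsub_scale_odot r (x y : rsub_sort) :
  rsub_scale r (odot x (star y))
    = odot (rsub_scale r x) (star (rsub_scale r y)).
Proof. by apply: val_inj; exact: scal_odot. Qed.
Lemma rsub_scale_sub (r q : {i01 R}) (x : rsub_sort) :
  rsub_scale (Num.max (r%:num - q%:num) 0)%:i01 x
    = odot (rsub_scale r x) (star (rsub_scale q x)).
Proof. by apply: val_inj; exact: scal_sub. Qed.
Lemma rsub_scaleM (r q : {i01 R}) (x : rsub_sort) :
  rsub_scale (r%:num * q%:num)%:i01 x = rsub_scale r (rsub_scale q x).
Proof. by apply: val_inj; exact: scalM. Qed.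
Lemma rsub_scale1 (x : rsub_sort) : rsub_scale 1%:i01 x = x.
Proof. by apply: val_inj; exact: scal1. Qed.

HB.instance Definition _ := MVAlgebra_isRiesz.Build R rsub_sort
  rsub_scale_odot rsub_scale_sub rsub_scaleM rsub_scale1.

End RieszSubTheory.

Section Generated.
Variables (R : realType) (V : rieszMVType R) (E : set V).

Definition rgen_set : set V :=
  [set a | forall S : rieszSub V, E `<=` S -> mvsub_set S a].

Lemma rgen0 : rgen_set 0.
Proof. by move=> S _; exact: mvsub0. Qed.
Lemma rgenD a b : rgen_set a -> rgen_set b -> rgen_set (a + b).
Proof. by move=> ha hb S ES; apply: mvsubD; [exact: ha | exact: hb]. Qed.
Lemma rgen_star a : rgen_set a -> rgen_set (star a).
Proof. by move=> ha S ES; apply: mvsub_star; exact: ha. Qed.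
Lemma rgen_scal (r : {i01 R}) a : rgen_set a -> rgen_set (scal r a).
Proof. by move=> ha S ES; apply: rsub_scal; exact: ha. Qed.

Definition rgen : rieszSub V :=
  RieszSub (rsub_mv := MVSub rgen0 rgenD rgen_star) rgen_scal.

End Generated.

Definition free_mv (X : Type) (F : mvType) (i : X -> F) : Prop :=
  forall (B : mvType) (f : X -> B),
    exists! h : F -> B, mv_hom h /\ forall x, h (i x) = f x.

Definition free_rmv (R : realType) (X : Type) (V : rieszMVType R) (j : X -> V) :
    Prop :=
  forall (W : rieszMVType R) (f : X -> W),
    exists! h : V -> W, riesz_hom h /\ forall x, h (j x) = f x.

HB.mixin Record isLGroup G of Num.POrderedZmodule G := {
  lmeet : G -> G -> G;
  ljoin : G -> G -> G;
  lg_le_meet : forall x y z : G, (x <= lmeet y z) = (x <= y) && (x <= z);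
  lg_join_le : forall x y z : G, (ljoin x y <= z) = (x <= z) && (y <= z);
  lg_leD2l : forall x y z : G, x <= y -> z + x <= z + y
}.

#[short(type="lgroupType")]
HB.structure Definition LGroup := {G of Num.POrderedZmodule G & isLGroup G}.

Definition lgroup_embedding (G D : lgroupType) (k : G -> D) : Prop :=
  [/\ injective k, {morph k : x y / x + y},
      {morph k : x y / lmeet x y} & {morph k : x y / ljoin x y}].

Record strongUnit (G : lgroupType) := StrongUnit {
  su_val : G;
  su_ge0 : 0 <= su_val;
  su_strong : forall x : G, exists n : nat, x <= su_val *+ n
}.

Section Gamma.
Variables (G : lgroupType) (u : strongUnit G).

Record gamma := Gamma { gamma_val : G; _ : 0 <= gamma_val <= su_val u }.
HB.instance Definition _ := [isSub for gamma_val].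
HB.instance Definition _ := [Choice of gamma by <:].

Implicit Types (x y z : G) (a b c : gamma).

Lemma lg_leD2r x y z : x <= y -> x + z <= y + z.
Proof. by rewrite ![_ + z]addrC; exact: lg_leD2l. Qed.

Lemma lg_leBlDr x y z : (x - y <= z) = (x <= z + y).
Proof.
apply/idP/idP => [/(@lg_leD2r _ _ y)|/(@lg_leD2r _ _ (- y))].
  by rewrite subrK.
by rewrite addrK.
Qed.

Lemma lg_leBrDr x y z : (x <= y - z) = (x + z <= y).
Proof. by rewrite -[z in RHS]opprK lg_leBlDr. Qed.

Lemma lg_subge0 x y : (0 <= y - x) = (x <= y).
Proof. by rewrite lg_leBrDr add0r. Qed.

Lemma lg_subCl x y z : (x - y <= z) = (x - z <= y).
Proof. by rewrite !lg_leBlDr addrC. Qed.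

Lemma lg_meetl x y : lmeet x y <= x.
Proof. by have := lexx (lmeet x y); rewrite lg_le_meet => /andP[]. Qed.

Lemma lg_meetr x y : lmeet x y <= y.
Proof. by have := lexx (lmeet x y); rewrite lg_le_meet => /andP[]. Qed.

Lemma lg_meet_l x y : x <= y -> lmeet x y = x.
Proof. by move=> xy; apply/eqP; rewrite eq_le lg_meetl lg_le_meet lexx. Qed.

Lemma lg_meet_r x y : y <= x -> lmeet x y = y.
Proof. by move=> yx; apply/eqP; rewrite eq_le lg_meetr lg_le_meet lexx andbT. Qed.

Lemma lg_meetA x y z : lmeet (lmeet x y) z = lmeet x (lmeet y z).
Proof.
have E t : (t <= lmeet (lmeet x y) z) = (t <= lmeet x (lmeet y z)).
  by rewrite !lg_le_meet andbA.
by apply/eqP; rewrite eq_le -E lexx E lexx.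
Qed.

Lemma lg_joinC x y : ljoin x y = ljoin y x.
Proof.
have E t : (ljoin x y <= t) = (ljoin y x <= t) by rewrite !lg_join_le andbC.
by apply/eqP; rewrite eq_le E lexx -E lexx.
Qed.

Lemma lg_meetDr x y z : lmeet x y + z = lmeet (x + z) (y + z).
Proof.
apply/eqP; rewrite eq_le lg_le_meet !lg_leD2r ?lg_meetl ?lg_meetr //=.
by rewrite -lg_leBlDr lg_le_meet !lg_leBlDr lg_meetl lg_meetr.
Qed.

Lemma gamma_ge0 a : 0 <= \val a.
Proof. by case: a => x /= /andP[]. Qed.

Lemma gamma_le a : \val a <= su_val u.
Proof. by case: a => x /= /andP[]. Qed.

Lemma gamma_zero_subproof : 0 <= (0 : G) <= su_val u.
Proof. by rewrite lexx su_ge0. Qed.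

Lemma gamma_add_subproof a b : 0 <= lmeet (\val a + \val b) (su_val u) <= su_val u.
Proof.
rewrite lg_meetr andbT lg_le_meet su_ge0 andbT.
apply: le_trans (gamma_ge0 b) _.
by rewrite -[X in X <= _]add0r lg_leD2r ?gamma_ge0.
Qed.

Lemma gamma_neg_subproof a : 0 <= su_val u - \val a <= su_val u.
Proof.
rewrite lg_leBrDr add0r gamma_le /= lg_leBlDr.
by rewrite -[X in X <= _]addr0 lg_leD2l ?gamma_ge0.
Qed.

Definition gamma_zero : gamma := Gamma gamma_zero_subproof.
Definition gamma_add a b : gamma := Gamma (gamma_add_subproof a b).
Definition gamma_neg a : gamma := Gamma (gamma_neg_subproof a).

Lemma gamma_addC : commutative gamma_add.
Proof. by move=> a b; apply: val_inj; rewrite /= addrC. Qed.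

Lemma gamma_leuD a : su_val u <= su_val u + \val a.
Proof. by rewrite -[X in X <= _]addr0 lg_leD2l ?gamma_ge0. Qed.

Lemma gamma_addAux a b c :
  \val (gamma_add (gamma_add a b) c)
    = lmeet (\val a + \val b + \val c) (su_val u).
Proof.
by rewrite /= lg_meetDr lg_meetA (lg_meet_r (gamma_leuD c)).
Qed.

Lemma gamma_addA : associative gamma_add.
Proof.
move=> a b c; apply: val_inj; rewrite gamma_addAux gamma_addC gamma_addAux.
by congr lmeet; rewrite addrC addrA.
Qed.

Lemma gamma_add0 : left_id gamma_zero gamma_add.
Proof. by move=> a; apply: val_inj; rewrite /= add0r lg_meet_l ?gamma_le. Qed.

HB.instance Definition _ :=
  GRing.isNmodule.Build gamma gamma_addA gamma_addC gamma_add0.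

Lemma gamma_negK a : gamma_neg (gamma_neg a) = a.
Proof. by apply: val_inj; rewrite /= subKr. Qed.

Lemma gamma_neg0D a : gamma_neg 0 + a = gamma_neg 0.
Proof. by apply: val_inj; rewrite /= subr0 lg_meet_r ?gamma_leuD. Qed.

Lemma gamma_join a b :
  \val (gamma_neg (gamma_neg a + b) + b) = ljoin (\val a) (\val b).
Proof.
have leP z : (su_val u - lmeet (su_val u - \val a + \val b) (su_val u) + \val b <= z)
    = (ljoin (\val a) (\val b) <= z).
  rewrite -lg_leBrDr lg_subCl lg_le_meet lg_join_le; congr andb.
    rewrite lg_leBlDr -addrA subrKC -lg_subge0.
    by rewrite addrAC [X in X - _]addrC addrK addrC lg_subge0.
  by rewrite lg_leBlDr -lg_subge0 [X in X - _]addrC addrK lg_subge0.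
have E : su_val u - lmeet (su_val u - \val a + \val b) (su_val u) + \val b
    = ljoin (\val a) (\val b).
  by apply/eqP; rewrite eq_le leP lexx -leP lexx.
by rewrite /= E lg_meet_l // lg_join_le !gamma_le.
Qed.

Lemma gamma_negDC a b :
  gamma_neg (gamma_neg a + b) + b = gamma_neg (gamma_neg b + a) + a.
Proof. by apply: val_inj; rewrite !gamma_join lg_joinC. Qed.

HB.instance Definition _ :=
  isMVAlgebra.Build gamma gamma_negK gamma_neg0D gamma_negDC.

End Gamma.

(* k exhibits D as the group of all fractions g / n, with g in G and n >= 1. *)
Definition divisible_hull (G D : lgroupType) (k : G -> D) : Prop :=
  [/\ lgroup_embedding k,
      forall (g : G) (n : nat), (0 < n)%N -> exists d : D, d *+ n = k g
    & forall d : D, exists (g : G) (n : nat), (0 < n)%N /\ d *+ n = k g].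

Definition dedekind_macneille (B C : mvType) (e : B -> C) : Prop :=
  [/\ mv_embedding e, mv_complete C
    & forall c : C, exists S : set B, mv_is_sup (e @` S) c].

(* A choice of G, G_d and of the completion of A_d in the construction of the
   Riesz hull of A; each of them is determined by A up to isomorphism. *)
Record rieszHullData (R : realType) (A : mvType) := RieszHullData {
  rh_semisimple : mv_semisimple A;
  rh_G : lgroupType;
  rh_u : strongUnit rh_G;
  rh_phi : A -> gamma rh_u;
  rh_phi_iso : mv_iso rh_phi;
  rh_Gd : lgroupType;
  rh_k : rh_G -> rh_Gd;
  rh_k_hull : divisible_hull rh_k;
  rh_ud : strongUnit rh_Gd;
  rh_udE : su_val rh_ud = rh_k (su_val rh_u);
  rh_C : rieszMVType R;
  rh_e : gamma rh_ud -> rh_C;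
  rh_e_completion : dedekind_macneille rh_e
}.

Arguments rh_phi {R A} r _.
Arguments rh_k {R A} r _.
Arguments rh_e {R A} r _.

Section RieszHull.
Variables (R : realType) (A : mvType) (D : rieszHullData R A).

(* b is the image of a in A_d = Gamma(G_d, u), then e b its image in the
   completion of A_d. *)
Definition rh_image : set (rh_C D) :=
  [set c | exists (a : A) (b : gamma (rh_ud D)),
     \val b = rh_k D (\val (rh_phi D a)) /\ c = rh_e D b].

Definition riesz_hull : rieszMVType R := rsub_sort (rgen rh_image).

End RieszHull.

(* Main.v *)
(* Both free algebras are algebras of functions on the cube Y = [0,1]^X: an element
   of an MV-chain is controlled by the total cone of the linear forms that are
   nonnegative at it in Chang's group, and a Fourier-Motzkin argument realizes
   the signs of finitely many such forms at a point of the cube, so that an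
   equation failing in a chain already fails in [0,1].  For Riesz MV-algebras the
   same argument works over the reals once the scalars act on Chang's group.

   Elements of the free Riesz MV-algebra V are thus continuous functions that
   depend on finitely many coordinates.  If v(p) > 0, a McNaughton tent at p of
   small enough support lies below a multiple of v, which makes the embedding of
   the free MV-algebra F in V essential.  A Riesz homomorphism from V to the
   completion of the divisible hull of F that is injective on F is therefore
   injective, and its image is the Riesz subalgebra generated by F. *)
Require Import Defs.
From HB Require Import structures.
From mathcomp Require Import all_boot all_order all_algebra.
From mathcomp Require Import zify ring lra.
From mathcomp Require Import boolp classical_sets reals interval_inference.

Set Implicit Arguments.
Unset Strict Implicit.
Unset Printing Implicit Defensive.

Import Order.TTheory GRing.Theory Num.Theory.

Local Open Scope classical_set_scope.
Local Open Scope ring_scope.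

(** * Arithmetic of MV-algebras *)

(** Chang's group of a chain need not be archimedean, so a chain does not embed in the reals and a
    failing equation cannot simply be carried over to [[0,1]]. Only signs are carried over: one term
    meets finitely many truncations, and the signs of finitely many forms can be matched at a real
    point whatever the order type of the group. Polynomials serve as linear forms, their constant
    coefficient standing for the unit.

    The isomorphism is claimed for every choice of hull data, so the existence of such data is a
    separate obligation; it is what requires an explicit group, divisible hull and completion. The
    obstacle there is that a pointwise supremum of continuous functions need not be continuous and
    may differ from the lattice supremum, which is why functions have to be identified up to small
    differences. The isomorphism argument never looks inside these models: it rests on freeness, on
    essentiality and on the given maps being embeddings. *)

Section MVArith.
Variable A : mvType.
Implicit Types a b c d w : A.

Definition mv_one : A := star 0.
Definition mv_sub a b : A := odot a (star b).

Lemma star1 : star mv_one = 0 :> A. Proof. exact: starK. Qed.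
Lemma star_inj : injective (@star A). Proof. exact: can_inj (@starK A). Qed.
Lemma mv_add1r a : mv_one + a = mv_one. Proof. exact: star0D. Qed.
Lemma mv_addr1 a : a + mv_one = mv_one. Proof. by rewrite addrC mv_add1r. Qed.

Lemma mv_starD a : star a + a = mv_one.
Proof. by have := starDC mv_one a; rewrite star1 add0r mv_addr1. Qed.
Lemma mv_addN a : a + star a = mv_one. Proof. by rewrite addrC mv_starD. Qed.

Lemma mv_subE a b : mv_sub a b = star (star a + b).
Proof. by rewrite /mv_sub /odot starK. Qed.

Lemma odotC a b : odot a b = odot b a. Proof. by rewrite /odot addrC. Qed.
Lemma odotA a b c : odot a (odot b c) = odot (odot a b) c.
Proof. by rewrite /odot !starK addrA. Qed.
Lemma odot1 a : odot a mv_one = a.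
Proof. by rewrite /odot star1 addr0 starK. Qed.
Lemma odot0 a : odot a 0 = 0.
Proof. by rewrite /odot mv_addr1 star1. Qed.
Lemma star_odot a b : star (odot a b) = star a + star b.
Proof. by rewrite /odot starK. Qed.
Lemma star_add a b : star (a + b) = odot (star a) (star b).
Proof. by rewrite /odot !starK. Qed.

Lemma mv_leE a b : mv_le a b <-> star a + b = mv_one.
Proof.
rewrite /mv_le -/(mv_sub a b) mv_subE; split=> h; last by rewrite h star1.
by apply: star_inj; rewrite h star1.
Qed.

Lemma mv_lexx a : mv_le a a. Proof. by apply/mv_leE; rewrite mv_starD. Qed.
Lemma mv_le0x a : mv_le 0 a. Proof. by apply/mv_leE; rewrite mv_add1r. Qed.
Lemma mv_lex1 a : mv_le a mv_one. Proof. by apply/mv_leE; rewrite mv_addr1. Qed.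

Lemma mv_joinC a b : mv_sub a b + b = mv_sub b a + a.
Proof. by rewrite !mv_subE starDC. Qed.

Lemma mv_subK a b : mv_le a b -> mv_sub b a + a = b.
Proof. by rewrite mv_joinC /mv_le /mv_sub => ->; rewrite add0r. Qed.

Lemma mv_le_anti a b : mv_le a b -> mv_le b a -> a = b.
Proof. by move=> /mv_subK h1 h2; rewrite -h1 /mv_sub h2 add0r. Qed.

Lemma mv_leDr a b : mv_le a (a + b).
Proof. by apply/mv_leE; rewrite addrA mv_starD mv_add1r. Qed.
Lemma mv_leDl a b : mv_le a (b + a). Proof. by rewrite addrC; exact: mv_leDr. Qed.

Lemma mv_le_trans b a c : mv_le a b -> mv_le b c -> mv_le a c.
Proof.
move=> /mv_subK <- /mv_subK <-.
by rewrite addrA; exact: mv_leDl.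
Qed.

Lemma mv_le_add2r c a b : mv_le a b -> mv_le (a + c) (b + c).
Proof. by move=> /mv_subK <-; rewrite -addrA; exact: mv_leDl. Qed.
Lemma mv_le_add2l c a b : mv_le a b -> mv_le (c + a) (c + b).
Proof. by rewrite ![c + _]addrC; exact: mv_le_add2r. Qed.
Lemma mv_leD a b c d : mv_le a b -> mv_le c d -> mv_le (a + c) (b + d).
Proof. by move=> h1 h2; apply: (mv_le_trans (mv_le_add2r c h1)); exact: mv_le_add2l. Qed.

Lemma mv_le_star a b : mv_le a b -> mv_le (star b) (star a).
Proof. by rewrite !mv_leE starK addrC. Qed.

Lemma mv_le_subLR a b c : mv_le (mv_sub a b) c <-> mv_le a (b + c).
Proof. by rewrite !mv_leE mv_subE starK addrA. Qed.

Lemma mv_le0 a : mv_le a 0 -> a = 0.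
Proof. by move=> /mv_le_anti; apply; exact: mv_le0x. Qed.

Lemma mv_sub0 a : mv_sub a 0 = a.
Proof. by rewrite mv_subE addr0 starK. Qed.
Lemma mv_sub0r a : mv_sub 0 a = 0. Proof. exact: mv_le0x. Qed.
Lemma mv_subxx a : mv_sub a a = 0. Proof. exact: mv_lexx. Qed.
Lemma mv_sub_le a b : mv_le (mv_sub a b) a.
Proof. by apply/mv_le_subLR; exact: mv_leDl. Qed.
Lemma mv_odot_le a b : mv_le (odot a b) a.
Proof. by rewrite -[b]starK; exact: mv_sub_le. Qed.
Lemma mv_le_sub2r c a b : mv_le a b -> mv_le (mv_sub a c) (mv_sub b c).
Proof. by rewrite !mv_subE => h; apply/mv_le_star/mv_le_add2r/mv_le_star. Qed.
Lemma mv_sub_star a b : mv_sub (star a) (star b) = mv_sub b a.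
Proof. by rewrite /mv_sub starK odotC. Qed.

Lemma mv_sub_eq0 a b : mv_sub a b = 0 -> mv_sub b a = 0 -> a = b.
Proof. exact: mv_le_anti. Qed.

Lemma odot_eq0 a b : odot a b = 0 <-> mv_le a (star b).
Proof. by rewrite /mv_le starK. Qed.

Lemma mv_addK a b : mv_le a (star b) -> mv_sub (a + b) b = a.
Proof.
move=> /mv_le_star; rewrite starK => h; apply: star_inj.
rewrite mv_subE starK star_add -/(mv_sub _ _).
exact: mv_subK.
Qed.

Lemma mv_join_le a b c : mv_le a c -> mv_le b c -> mv_le (mv_sub a b + b) c.
Proof.
move=> /(mv_le_sub2r b) /(mv_le_add2r b) h hb.
by apply: mv_le_trans h _; rewrite mv_subK //; exact: mv_lexx.
Qed.

(** Writing [-] for [mv_sub], the hypotheses give [a - w = a], hence both [a + w = a] and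
    [w <= star a]. The second makes [w + a] cancellable, so [w = (w + a) - a = a - a = 0]. *)
Lemma mv_sub_self_eq0 a w : mv_le w a -> mv_le a (mv_sub a w) -> w = 0.
Proof.
move=> wa aw; have e : mv_sub a w = a by apply: mv_le_anti => //; exact: mv_sub_le.
have := mv_subK wa; rewrite e => h.
have hw : mv_le w (star a).
  have := mv_starD a; rewrite -[in X in _ + X]e mv_subE.
  have := e; rewrite mv_subE => /(congr1 (@star A)); rewrite starK => <-.
  by move=> _; rewrite addrC; exact: mv_leDr.
have ha : mv_le a (star w) by move/mv_le_star: hw; rewrite starK.
have := mv_addK hw; rewrite addrC h => <-; exact: mv_subxx.
Qed.

(* [a (-) b] and [b (-) a] are disjoint: subtracting a common lower bound [w]
   from the join [a + (b (-) a)] leaves an upper bound of [a] and [b]. *)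
Lemma mv_prelinear a b w :
  mv_le w (mv_sub a b) -> mv_le w (mv_sub b a) -> w = 0.
Proof.
move=> wa wb; set j := mv_sub a b + b.
have aux c d : mv_le w (mv_sub d c) -> j = mv_sub d c + c -> mv_le c (mv_sub j w).
  move=> h jE.
  have cw : mv_le c (star w).
    apply: mv_le_trans (mv_le_star h).
    by rewrite mv_subE starK; exact: mv_leDl.
  rewrite -(mv_addK cw); apply: mv_le_sub2r; rewrite jE addrC.
  exact: mv_le_add2r.
apply: (@mv_sub_self_eq0 j).
  by apply: mv_le_trans wa _; exact: mv_leDr.
apply: mv_join_le; first by apply: (aux _ b) => //; rewrite /j mv_joinC.
exact: (aux _ a).
Qed.

(** One copy of each difference is [mv_prelinear] applied to [mv_sub z c]; further copies are
    absorbed into [p] one at a time, first on one side and then on the other. This is the step that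
    makes a maximal ideal avoiding [z] prime. *)
Lemma mv_prelinear_mul a b z p n m :
  mv_le z (mv_sub a b *+ n + p) -> mv_le z (mv_sub b a *+ m + p) -> mv_le z p.
Proof.
have step1 c : mv_le z (mv_sub a b + c) -> mv_le z (mv_sub b a + c) -> mv_le z c.
  rewrite ![_ + c]addrC -!mv_le_subLR => h1 h2; exact: (mv_prelinear h1 h2).
have step2 k c : mv_le z (mv_sub a b + c) -> mv_le z (mv_sub b a *+ k + c) -> mv_le z c.
  elim: k c => [|k IH] c h1; first by rewrite mulr0n add0r.
  rewrite mulrS -addrA => h2; apply: (IH) => //; apply: step1 => //.
  by apply: mv_le_trans h1 _; apply: mv_le_add2l; exact: mv_leDl.
elim: n => [|n IH]; first by rewrite mulr0n add0r.
rewrite mulrS -addrA => h1 h2; apply: (IH) => //; apply: step2 h1 _.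
by apply: mv_le_trans h2 _; apply: mv_le_add2l; exact: mv_leDl.
Qed.


Lemma mv_trisub a b c : mv_le (mv_sub a c) (mv_sub a b + mv_sub b c).
Proof.
apply/mv_le_subLR.
have h1 : mv_le a (b + mv_sub a b) by apply/mv_le_subLR; exact: mv_lexx.
apply: mv_le_trans h1 _; rewrite [X in mv_le _ (_ + X)]addrC addrA.
by apply: mv_le_add2r; apply/mv_le_subLR; exact: mv_lexx.
Qed.

Lemma mv_sub_add2r a b c : mv_le (mv_sub (a + c) (b + c)) (mv_sub a b).
Proof.
apply/mv_le_subLR; rewrite addrAC; apply: mv_le_add2r.
by apply/mv_le_subLR; exact: mv_lexx.
Qed.

End MVArith.

Section MVHom.
Variables (A B : mvType) (f : A -> B).
Hypothesis hf : mv_hom f.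

Lemma mv_hom0 : f 0 = 0. Proof. by case: hf. Qed.
Lemma mv_homD a b : f (a + b) = f a + f b. Proof. by case: hf => _ h _; exact: h. Qed.
Lemma mv_hom_star a : f (star a) = star (f a). Proof. by case: hf => _ _ h; exact: h. Qed.
Lemma mv_hom_odot a b : f (odot a b) = odot (f a) (f b).
Proof. by rewrite /odot mv_hom_star mv_homD !mv_hom_star. Qed.
Lemma mv_hom_sub a b : f (mv_sub a b) = mv_sub (f a) (f b).
Proof. by rewrite /mv_sub mv_hom_odot mv_hom_star. Qed.
Lemma mv_homMn a n : f (a *+ n) = f a *+ n.
Proof. by elim: n => [|n IH]; rewrite ?mulr0n ?mv_hom0 // !mulrS mv_homD IH. Qed.
Lemma mv_hom_le a b : mv_le a b -> mv_le (f a) (f b).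
Proof.
by rewrite /mv_le => /(congr1 f); rewrite mv_hom0 mv_hom_odot mv_hom_star.
Qed.

Lemma mv_hom_inj : (forall a, f a = 0 -> a = 0) -> injective f.
Proof.
move=> h a b e; apply: mv_sub_eq0; apply: h.
  by rewrite mv_hom_sub e mv_subxx.
by rewrite mv_hom_sub e mv_subxx.
Qed.

Lemma mv_hom_le_inj : injective f -> forall a b, mv_le (f a) (f b) -> mv_le a b.
Proof.
move=> finj a b h; apply: finj; rewrite mv_hom0 mv_hom_odot mv_hom_star; exact: h.
Qed.
End MVHom.

(** * Ideals, quotients and chains *)

Section Ideal.
Variables (A : mvType) (I : set A).
Hypothesis hI : mv_ideal I.

Lemma mv_ideal0 : I 0.
Proof. by case: hI => -[a Ia] h _; apply: h Ia; exact: mv_le0x. Qed.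
Lemma mv_ideal_le a b : mv_le a b -> I b -> I a.
Proof. by case: hI => _ h _; exact: h. Qed.
Lemma mv_idealD a b : I a -> I b -> I (a + b).
Proof. by case: hI => _ _; apply. Qed.
Lemma mv_idealMn a n : I a -> I (a *+ n).
Proof.
move=> Ia; elim: n => [|n IH]; first by rewrite mulr0n; exact: mv_ideal0.
by rewrite mulrS; exact: mv_idealD.
Qed.

Definition mv_cong (a b : A) : bool := `[< I (mv_sub a b) /\ I (mv_sub b a) >].

Lemma mv_congP a b : reflect (I (mv_sub a b) /\ I (mv_sub b a)) (mv_cong a b).
Proof. exact: asboolP. Qed.

Lemma mv_cong_refl : reflexive mv_cong.
Proof. by move=> a; apply/mv_congP; rewrite mv_subxx; split; exact: mv_ideal0. Qed.
Lemma mv_cong_sym : symmetric mv_cong.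
Proof. by move=> a b; apply/mv_congP/mv_congP => -[]. Qed.
Lemma mv_cong_trans : transitive mv_cong.
Proof.
move=> b a c /mv_congP[h1 h2] /mv_congP[h3 h4]; apply/mv_congP; split.
  by apply: mv_ideal_le (mv_trisub a b c) _; exact: mv_idealD.
by apply: mv_ideal_le (mv_trisub c b a) _; exact: mv_idealD.
Qed.

Lemma mv_congD a b a' b' : mv_cong a a' -> mv_cong b b' -> mv_cong (a + b) (a' + b').
Proof.
move=> h1 h2; apply: (@mv_cong_trans (a' + b)).
  by move/mv_congP: h1 => [x y]; apply/mv_congP; split; apply: mv_ideal_le (mv_sub_add2r _ _ _) _.
rewrite ![a' + _]addrC.
by move/mv_congP: h2 => [x y]; apply/mv_congP; split; apply: mv_ideal_le (mv_sub_add2r _ _ _) _.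
Qed.

Lemma mv_cong_star a b : mv_cong a b -> mv_cong (star a) (star b).
Proof. by move=> /mv_congP[x y]; apply/mv_congP; rewrite !mv_sub_star. Qed.

Lemma mv_cong0 a : mv_cong a 0 = `[< I a >].
Proof.
apply/mv_congP/asboolP; rewrite mv_sub0 mv_sub0r; first by case.
by move=> Ia; split => //; exact: mv_ideal0.
Qed.

Definition mv_equiv : equiv_rel A :=
  EquivRel mv_cong mv_cong_refl mv_cong_sym mv_cong_trans.

Definition mvquot : Type := {eq_quot mv_equiv}%qT.
HB.instance Definition _ := Choice.on mvquot.

Definition mvpi (a : A) : mvquot := (\pi_({eq_quot mv_equiv}) a)%qT.

Definition mvrepr (q : mvquot) : A := @repr _ {eq_quot mv_equiv}%qT q.

Lemma mvpi_eq a b : mvpi a = mvpi b <-> mv_cong a b.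
Proof.
split=> [h|/(eqmodP mv_equiv) //].
by apply/(eqmodP mv_equiv).
Qed.

Lemma mvreprK q : mvpi (mvrepr q) = q.
Proof. by rewrite /mvpi /mvrepr reprK. Qed.

Lemma mvrepr_cong a : mv_cong (mvrepr (mvpi a)) a.
Proof. by apply/mvpi_eq; rewrite mvreprK. Qed.

Definition mvq_zero : mvquot := mvpi 0.
Definition mvq_add (p q : mvquot) : mvquot := mvpi (mvrepr p + mvrepr q).
Definition mvq_neg (p : mvquot) : mvquot := mvpi (star (mvrepr p)).

Lemma mvq_addE a b : mvq_add (mvpi a) (mvpi b) = mvpi (a + b).
Proof. by apply/mvpi_eq; apply: mv_congD; exact: mvrepr_cong. Qed.
Lemma mvq_negE a : mvq_neg (mvpi a) = mvpi (star a).
Proof. by apply/mvpi_eq; apply: mv_cong_star; exact: mvrepr_cong. Qed.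

Lemma mvq_addA : associative mvq_add.
Proof.
move=> p q r; rewrite -[p]mvreprK -[q]mvreprK -[r]mvreprK.
by rewrite !mvq_addE addrA.
Qed.
Lemma mvq_addC : commutative mvq_add.
Proof. by move=> p q; rewrite -[p]mvreprK -[q]mvreprK !mvq_addE addrC. Qed.
Lemma mvq_add0 : left_id mvq_zero mvq_add.
Proof. by move=> p; rewrite -[p]mvreprK mvq_addE add0r. Qed.

HB.instance Definition _ :=
  GRing.isNmodule.Build mvquot mvq_addA mvq_addC mvq_add0.

Lemma mvq_negK p : mvq_neg (mvq_neg p) = p.
Proof. by rewrite -[p]mvreprK !mvq_negE starK. Qed.
Lemma mvq_neg0D (p : mvquot) : mvq_neg 0 + p = mvq_neg 0.
Proof.
have e : mvq_neg 0 = mvpi (star 0) := mvq_negE 0.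
rewrite e -[p]mvreprK -[LHS]/(mvq_add _ _) mvq_addE.
by rewrite star0D.
Qed.
Lemma mvq_negDC (p q : mvquot) :
  mvq_neg (mvq_neg p + q) + q = mvq_neg (mvq_neg q + p) + p.
Proof.
have addE a b : mvpi a + mvpi b = mvpi (a + b) := mvq_addE a b.
rewrite -[p]mvreprK -[q]mvreprK; move: mvq_neg mvq_negE => neg negE.
by rewrite !(negE, addE) starDC.
Qed.

HB.instance Definition _ := isMVAlgebra.Build mvquot mvq_negK mvq_neg0D mvq_negDC.

Lemma mvpi_hom : mv_hom mvpi.
Proof.
split=> // [a b|a]; first exact: (esym (mvq_addE a b)).
exact: (esym (mvq_negE a)).
Qed.

Lemma mvpi_eq0 a : mvpi a = 0 <-> I a.
Proof.
split=> [/(mvpi_eq a 0)|h]; first by rewrite mv_cong0 => /asboolP.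
by apply/(mvpi_eq a 0); rewrite mv_cong0; apply/asboolP.
Qed.

Lemma mvpi_le a b : mv_le (mvpi a) (mvpi b) <-> I (mv_sub a b).
Proof. by rewrite -mvpi_eq0 (mv_hom_sub mvpi_hom). Qed.

End Ideal.

(** * Scalars in Riesz MV-algebras and their quotients *)

Section RieszArith.
Variables (R : realType) (V : rieszMVType R).
Implicit Types (a b : V) (s r q : {i01 R}).

Lemma scal_mvsub r a b : scal r (mv_sub a b) = mv_sub (scal r a) (scal r b).
Proof. exact: scal_odot. Qed.

Lemma scal_0 r : scal r (0 : V) = 0.
Proof. by rewrite -[X in scal _ X](mv_subxx 0) scal_mvsub mv_subxx. Qed.

Lemma scal_le r a b : mv_le a b -> mv_le (scal r a) (scal r b).
Proof.
by rewrite /mv_le => h; rewrite -scal_odot h scal_0.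
Qed.


(** The axioms speak of differences only. For orthogonal [a] and [b] the sum is not truncated, so
    [a] is the difference of [a + b] and [b], and additivity is the difference law read
    backwards. *)
Lemma scal_addr r a b :
  mv_le a (star b) -> scal r (a + b) = scal r a + scal r b.
Proof.
move=> h; rewrite -{2}(mv_addK h) scal_mvsub mv_subK //.
by apply: scal_le; exact: mv_leDl.
Qed.

Lemma scal_subE s r q a : s%:num = Num.max (r%:num - q%:num) 0 ->
  scal s a = mv_sub (scal r a) (scal q a).
Proof. by move=> h; rewrite -[RHS]scal_sub; congr scal; exact: val_inj. Qed.

Lemma scal_mulE s r q a : s%:num = r%:num * q%:num ->
  scal s a = scal r (scal q a).
Proof. by move=> h; rewrite -scalM; congr scal; exact: val_inj. Qed.

Lemma scal0_le r q a : r%:num <= q%:num -> mv_le (scal r a) (scal q a).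
Proof.
move=> rq; rewrite /mv_le -scal_sub.
rewrite (@scal_subE _ r r) ?mv_subxx //= subrr maxxx.
by apply/max_idPr; rewrite subr_le0.
Qed.

(** Because of this, every MV-ideal is stable under scalars and its quotient is again a Riesz
    MV-algebra. *)
Lemma scal_le_id r a : mv_le (scal r a) a.
Proof.
rewrite -[X in mv_le _ X]scal1; apply: scal0_le => /=.
exact: le1.
Qed.

End RieszArith.

Section RieszQuot.
Variables (R : realType) (V : rieszMVType R) (I : set V).
Hypothesis hI : mv_ideal I.

Definition rquot : Type := mvquot hI.
HB.instance Definition _ := MVAlgebra.on rquot.

Definition rq_scal (r : {i01 R}) (p : rquot) : rquot := mvpi hI (scal r (mvrepr p)).

Lemma rq_scalE r a : rq_scal r (mvpi hI a) = mvpi hI (scal r a).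
Proof.
apply/mvpi_eq; case/mv_congP: (mvrepr_cong hI a) => h1 h2.
apply/mv_congP; rewrite -!scal_mvsub.
by split; apply: mv_ideal_le (scal_le_id _ _) _.
Qed.

Lemma rq_scal_odot r (x y : rquot) :
  rq_scal r (odot x (star y)) = odot (rq_scal r x) (star (rq_scal r y)).
Proof.
have hpi := mvpi_hom hI.
rewrite -[x]mvreprK -[y]mvreprK -!/(mv_sub _ _) -(mv_hom_sub hpi) !rq_scalE.
by rewrite -(mv_hom_sub hpi) scal_mvsub.
Qed.
Lemma rq_scal_sub (r q : {i01 R}) (x : rquot) :
  rq_scal (Num.max (r%:num - q%:num) 0)%:i01 x = odot (rq_scal r x) (star (rq_scal q x)).
Proof.
have hpi := mvpi_hom hI.
by rewrite -[x]mvreprK !rq_scalE -/(mv_sub _ _) -(mv_hom_sub hpi) scal_sub.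
Qed.
Lemma rq_scalM (r q : {i01 R}) (x : rquot) :
  rq_scal (r%:num * q%:num)%:i01 x = rq_scal r (rq_scal q x).
Proof. by rewrite -[x]mvreprK !rq_scalE scalM. Qed.
Lemma rq_scal1 (x : rquot) : rq_scal 1%:i01 x = x.
Proof. by rewrite -[x]mvreprK !rq_scalE scal1. Qed.

HB.instance Definition _ := MVAlgebra_isRiesz.Build R rquot
  rq_scal_odot rq_scal_sub rq_scalM rq_scal1.

Definition rpi (a : V) : rquot := mvpi hI a.

Lemma rpi_hom : riesz_hom rpi.
Proof.
split; first exact: mvpi_hom.
by move=> r a; exact: (esym (rq_scalE r a)).
Qed.
End RieszQuot.

Section PrimeIdeal.
Variables (A : mvType).

Definition mv_total := forall a b : A, mv_le a b \/ mv_le b a.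

Lemma mv_ideal_gen (I : set A) (c : A) : mv_ideal I ->
  mv_ideal [set a | exists n p, I p /\ mv_le a (c *+ n + p)].
Proof.
move=> hI; split.
- by exists 0, 0%N, 0; split; [exact: mv_ideal0 | exact: mv_le0x].
- by move=> a b ab [n [p [Ip h]]]; exists n, p; split=> //; exact: mv_le_trans ab h.
- move=> a b [n [p [Ip h]]] [m [q [Iq h']]]; exists (n + m)%N, (p + q).
  split; first exact: mv_idealD.
  by rewrite mulrnDr addrACA; exact: mv_leD.
Qed.

(** An ideal maximal among those avoiding [z] is prime: if both differences lay outside, adjoining
    either would capture [z], and [mv_prelinear_mul] would put [z] below an element of the ideal
    itself. *)
Lemma mv_prime_ideal (z : A) : z <> 0 ->
  exists I : set A, [/\ mv_ideal I, ~ I z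
    & forall a b, I (mv_sub a b) \/ I (mv_sub b a)].
Proof.
move=> z0.
(* Zorn is applied to unions of chains, including the empty chain, whose union is empty and hence
   not an ideal; adjoining 0 covers that case. *)
pose P (J : set A) := mv_ideal (J `|` [set 0]) /\ ~ (J `|` [set 0]) z.
have [F FP tF|I [[hI Iz] Imax]] := @Zorn_bigcup A P.
  have same a b : (\bigcup_(J in F) J `|` [set 0]) a -> (\bigcup_(J in F) J `|` [set 0]) b ->
      (exists2 J, P J /\ J `<=` \bigcup_(J in F) J & (J `|` [set 0]) a /\ (J `|` [set 0]) b)
      \/ (a = 0 /\ b = 0).
    have sF J : F J -> P J /\ J `<=` \bigcup_(J in F) J.
      by move=> FJ; split; [exact: FP | move=> x Jx; exists J].
    case=> [[J FJ Ja]|a0]; case=> [[K FK Kb]|b0].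
    - case: (tF J K FJ FK) => [JK|KJ]; left.
        by exists K; [exact: sF | split; left => //; exact: JK].
      by exists J; [exact: sF | split; left => //; exact: KJ].
    - by left; exists J; [exact: sF | split; [left|right]].
    - by left; exists K; [exact: sF | split; [right|left]].
    - by right.
  split.
    split.
    - by exists 0; right.
    - move=> a b ab Fb; case: (same b b Fb Fb) => [[J [[hJ _] sJ] [Jb _]]|[b0 _]].
        by case: (mv_ideal_le hJ ab Jb) => [/sJ|->]; [left | right].
      by right; apply: mv_le0; rewrite -b0.
    - move=> a b Fa Fb; case: (same a b Fa Fb) => [[J [[hJ _] sJ] [Ja Jb]]|[-> ->]].
        by case: (mv_idealD hJ Ja Jb) => [/sJ|->]; [left | right].
      by right; rewrite /= addr0.
  by case=> [[J FJ Jz]|//]; case: (FP J FJ) => _; apply; left.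
exists (I `|` [set 0]); split=> // a b.
have key c : ~ (I `|` [set 0]) c ->
    exists n p, (I `|` [set 0]) p /\ mv_le z (c *+ n + p).
  move=> Ic; set J := [set a | exists n p, (I `|` [set 0]) p /\ mv_le a (c *+ n + p)].
  have hJ : mv_ideal J := mv_ideal_gen c hI.
  have J0 : J `|` [set 0] = J.
    by apply/seteqP; split=> [x [//|->]|x]; [exact: mv_ideal0 hJ | left].
  have IJ : I `<=` J.
    move=> x Ix; exists 0%N, x; split; first by left.
    by rewrite mulr0n add0r; exact: mv_lexx.
  apply: contrapT => Jz; apply: Ic; left.
  suff <- : J = I.
    exists 1%N, 0; split; first by right.
    by rewrite mulr1n addr0; exact: mv_lexx.
  apply: contrapT => neJI; apply: (Imax J).
    by split=> // JI; apply: neJI; apply/seteqP.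
  by split; rewrite J0.
case: (pselect ((I `|` [set 0]) (mv_sub a b))) => [|h1]; first by left.
case: (pselect ((I `|` [set 0]) (mv_sub b a))) => [|h2]; first by right.
have [n [p [Ip hp]]] := key _ h1; have [m [q [Iq hq]]] := key _ h2.
case: Iz; apply: (mv_ideal_le hI _ (mv_idealD hI Ip Iq)).
apply: (@mv_prelinear_mul _ a b _ _ n m).
  by apply: mv_le_trans hp _; apply: mv_le_add2l; exact: mv_leDr.
by apply: mv_le_trans hq _; apply: mv_le_add2l; exact: mv_leDl.
Qed.

End PrimeIdeal.

Lemma mvquot_total (A : mvType) (I : set A) (hI : mv_ideal I) :
  (forall a b, I (mv_sub a b) \/ I (mv_sub b a)) -> mv_total (mvquot hI).
Proof.
move=> h p q; rewrite -[p]mvreprK -[q]mvreprK.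
by case: (h (mvrepr p) (mvrepr q)) => H; [left|right]; apply/mvpi_le.
Qed.

(** * Chang's group of an MV-chain *)

Section Mid.
Variable A : mvType.
Implicit Types a b c : A.

(** If neither [a + b] nor [b + c] overflows, both sides are the excess of [a + b + c] over the
    unit. This lemma and the next two match the carry patterns in the associativity of Chang's
    addition: no carry, two carries, one carry. *)
Lemma mv_odot_mid a b c :
  mv_le a (star b) -> mv_le b (star c) -> odot (a + b) c = odot a (b + c).
Proof.
have half x y z : mv_le y (star z) -> mv_le (odot (x + y) z) (odot x (y + z)).
  move=> yz; rewrite -{1}(starK z) -[odot _ (star (star z))]/(mv_sub _ _).
  apply/mv_le_subLR; rewrite -(mv_subK yz) -[y + z]starK -[odot x _]/(mv_sub _ _).
  have -> : mv_sub (star z) y = star (y + z) by rewrite mv_subE starK [z + y]addrC.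
  rewrite addrAC [_ + mv_sub _ _]addrC; apply: mv_le_add2r.
  by rewrite mv_joinC; exact: mv_leDl.
move=> ab bc; apply: mv_le_anti; first exact: half.
rewrite odotC [odot (a + b) c]odotC [b + c]addrC [a + b]addrC; apply: half.
by move/mv_le_star: ab; rewrite starK.
Qed.

Lemma mv_addodot_mid a b c :
  a + b = mv_one A -> b + c = mv_one A -> odot a b + c = a + odot b c.
Proof.
move=> ab bc; apply: star_inj; rewrite !star_add !star_odot; apply: mv_odot_mid.
  by apply/mv_leE; rewrite !starK.
by apply/mv_leE; rewrite !starK.
Qed.

Lemma mv_odotD_mid a b c :
  a + b = mv_one A -> mv_le b (star c) -> odot a b + c = odot a (b + c).
Proof.
move=> ab bc.
have ba : mv_le (star b) a by apply/mv_leE; rewrite starK addrC.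
have ab' : mv_le (star a) b by apply/mv_leE; rewrite starK.
have cb : mv_le c (star b) by move/mv_le_star: bc; rewrite starK.
have h : mv_le (odot a b + c) (star (star a)).
  rewrite starK -{2}(mv_subK ba) /mv_sub starK; exact: mv_le_add2l.
rewrite -{1}(mv_addK h) /mv_sub starK odotC; congr odot.
by rewrite -{2}(mv_subK ab') /mv_sub starK [odot b a]odotC addrAC.
Qed.
End Mid.

Section Chang.
Variables (C : mvType) (tot : mv_total C) (nt : mv_one C != 0).
Implicit Types (a b c : C) (m n : int).

Local Notation one := (mv_one C).

Lemma mv_total_odot a b : a + b != one -> mv_le a (star b).
Proof.
case: (tot a (star b)) => // /mv_leE; rewrite starK addrC => ->.
by rewrite eqxx.
Qed.

(* Chang's group: [(m, a)] stands for [m u + a], with [a < u]. *)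
Definition chang_of (_ : mv_total C) (_ : mv_one C != 0) : Type :=
  {p : int * C | p.2 != one}.
Local Notation chang := (chang_of tot nt).
HB.instance Definition _ := SubChoice.on chang.
Implicit Types x y z : chang.

Lemma chang_zero_subproof : ((0, 0) : int * C).2 != one.
Proof. by rewrite eq_sym. Qed.

(** The pair [(m, one)] is normalized to [(m + 1, 0)], so the argument of [insubd] is always valid
    and its default is never reached. *)
Definition chang_mk m a : chang :=
  insubd (exist _ (0, 0) chang_zero_subproof : chang)
    (if a == one then (m + 1, 0) else (m, a)).

Lemma chang_mk_val m a :
  \val (chang_mk m a) = if a == one then (m + 1, 0) else (m, a).
Proof.
rewrite /chang_mk val_insubd; case: (altP (a =P one)) => [_|h] /=.
  by rewrite eq_sym nt.
by rewrite h.
Qed.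

Lemma chang_mkK x : chang_mk (\val x).1 (\val x).2 = x.
Proof. by apply: val_inj; rewrite chang_mk_val (negPf (valP x)) -surjective_pairing. Qed.

Lemma chang_mk1 m : chang_mk m one = chang_mk (m + 1) 0.
Proof. by apply: val_inj; rewrite !chang_mk_val eqxx eq_sym (negPf nt). Qed.

(** In a chain either [a + b] is the unit, and then [odot a b] is the excess left after a carry, or
    the sum is not truncated at all. *)
Definition chang_carry (m : int) a b : chang :=
  if a + b == one then chang_mk (m + 1) (odot a b) else chang_mk m (a + b).

Definition chang_zero : chang := chang_mk 0 0.
(** From [- (m u + a) = (- m - 1) u + (u - a)]; the result is not normalized when [a = 0], which
    [chang_mk] repairs. *)
Definition chang_opp x : chang := chang_mk (- (\val x).1 - 1) (star (\val x).2).
Definition chang_add x y : chang :=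
  chang_carry ((\val x).1 + (\val y).1) (\val x).2 (\val y).2.

Lemma chang_carryC m a b : chang_carry m a b = chang_carry m b a.
Proof. by rewrite /chang_carry addrC odotC. Qed.

Lemma chang_carry1 m a : chang_carry m one a = chang_carry (m + 1) 0 a.
Proof.
rewrite /chang_carry mv_add1r eqxx odotC odot1 add0r.
by case: eqP => // ->; rewrite odotC odot0 chang_mk1.
Qed.

Lemma chang_addE m n a b :
  chang_add (chang_mk m a) (chang_mk n b) = chang_carry (m + n) a b.
Proof.
rewrite /chang_add !chang_mk_val.
case: (altP (a =P one)) => [->|_]; case: (altP (b =P one)) => [->|_] /=.
- rewrite chang_carry1 chang_carryC chang_carry1; congr chang_carry; lia.
- by rewrite chang_carry1; congr chang_carry; lia.
- by rewrite [in RHS]chang_carryC chang_carry1 chang_carryC; congr chang_carry; lia.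
- by [].
Qed.

Lemma chang_addC : commutative chang_add.
Proof. by move=> x y; rewrite /chang_add addrC chang_carryC. Qed.

Lemma chang_add0 : left_id chang_zero chang_add.
Proof.
move=> x; rewrite -[x]chang_mkK chang_addE /chang_carry !add0r.
by rewrite (negPf (valP x)).
Qed.

Lemma chang_addN : left_inverse chang_zero chang_opp chang_add.
Proof.
move=> x; rewrite -{2}[x]chang_mkK chang_addE /chang_carry mv_starD eqxx odotC.
have -> : odot (\val x).2 (star (\val x).2) = 0 by exact: mv_subxx.
by congr chang_mk; lia.
Qed.

Lemma chang_carryA m n p a b c :
  chang_add (chang_carry (m + n) a b) (chang_mk p c)
  = chang_add (chang_mk m a) (chang_carry (n + p) b c).
Proof.
rewrite /chang_carry.
case: (altP (a + b =P one)) => ab; case: (altP (b + c =P one)) => bc;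
  rewrite !chang_addE /chang_carry.
- rewrite (mv_addodot_mid ab bc); case: eqP => _; last by congr chang_mk; lia.
  rewrite odotA; congr chang_mk; lia.
- have h := mv_total_odot bc.
  rewrite addrA ab mv_add1r eqxx (mv_odotD_mid ab h) ifN.
    by congr chang_mk; lia.
  (* No second carry can occur: it would give [one = odot a b + c <= b + c], against [bc]. The next
     case is its mirror image. *)
  apply: contra bc => /eqP e; apply/eqP/mv_le_anti; first exact: mv_lex1.
  rewrite -e -(mv_odotD_mid ab h); apply: mv_le_add2r; rewrite odotC.
  exact: mv_odot_le.
- have h : mv_le b (star a) by apply: mv_total_odot; rewrite addrC.
  have cb : c + b = one by rewrite addrC.
  rewrite -addrA bc mv_addr1 eqxx [odot _ c]odotC [a + b]addrC.
  rewrite [a + _]addrC [odot b c]odotC (mv_odotD_mid cb h) ifN.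
    by congr chang_mk; lia.
  apply: contra ab => /eqP e; apply/eqP/mv_le_anti; first exact: mv_lex1.
  rewrite -e -(mv_odotD_mid cb h) addrC; apply: mv_le_add2l; rewrite odotC.
  exact: mv_odot_le.
- have h1 := mv_total_odot ab; have h2 := mv_total_odot bc.
  rewrite addrA; case: eqP => _; last by congr chang_mk; lia.
  by rewrite (mv_odot_mid h1 h2); congr chang_mk; lia.
Qed.

Lemma chang_addA : associative chang_add.
Proof.
move=> x y z; rewrite -[x]chang_mkK -[y]chang_mkK -[z]chang_mkK.
by rewrite [chang_add (chang_mk _ _) (chang_mk (\val z).1 _)]chang_addE
  [X in chang_add X (chang_mk (\val z).1 _)]chang_addE chang_carryA.
Qed.

HB.instance Definition _ := GRing.isZmodule.Build chang
  chang_addA chang_addC chang_add0 chang_addN.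

(** The positive cone of Chang's group: the second component lies between 0 and the unit, so the
    integer part decides the sign. *)
Definition chang_nneg x : bool := 0 <= (\val x).1.
Definition chang_inj a : chang := chang_mk 0 a.

Lemma chang_inj_nneg a : chang_nneg (chang_inj a).
Proof. by rewrite /chang_nneg chang_mk_val; case: eqP. Qed.

Lemma chang_inj0 : chang_inj 0 = 0. Proof. by []. Qed.

Lemma chang_mkE m a : chang_mk m a = chang_inj one *~ m + chang_inj a.
Proof.
have stepm k : chang_mk (k + 1) 0 = chang_mk k 0 + chang_inj one.
  rewrite [RHS]chang_addE /chang_carry mv_addr1 eqxx odot1; congr chang_mk; lia.
have h k : chang_mk k 0 = chang_inj one *~ k.
  elim/int_ind: k => [|k IH|k IH]; first by rewrite mulr0z.
    by rewrite -addn1 PoszD stepm IH mulrzDr.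
  apply: (@addIr _ (chang_inj one)); rewrite -stepm.
  have -> : - k.+1%:Z + 1 = - k%:Z by lia.
  by rewrite IH -[X in _ + X](mulr1z) -mulrzDr; congr (_ *~ _); lia.
rewrite -h [RHS]chang_addE addr0 /chang_carry add0r; case: eqP => // ->.
by rewrite odot1 chang_mk1.
Qed.

Lemma chang_injD a b : mv_le a (star b) -> chang_inj (a + b) = chang_inj a + chang_inj b.
Proof.
move=> h; rewrite [RHS]chang_addE /chang_carry addr0; case: eqP => // e.
by rewrite (proj2 (odot_eq0 _ _) h) e /chang_inj chang_mk1.
Qed.

Lemma chang_inj_star a : chang_inj (star a) = chang_inj one - chang_inj a.
Proof.
apply: (@addIr _ (chang_inj a)); rewrite subrK -chang_injD ?mv_starD //.
exact: mv_lexx.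
Qed.

Lemma chang_injD1 a b : a + b = one ->
  chang_inj a + chang_inj b = chang_inj one + chang_inj (odot a b).
Proof.
move=> h; rewrite [LHS]chang_addE /chang_carry h eqxx addr0.
by rewrite chang_mkE mulr1z.
Qed.

Lemma chang_nnegD x y : chang_nneg x -> chang_nneg y -> chang_nneg (x + y).
Proof.
rewrite /chang_nneg => hx hy; have -> : x + y = chang_add x y by [].
rewrite /chang_add /chang_carry; case: eqP => _; rewrite chang_mk_val; case: eqP => _.
all: by move: (\val x) (\val y) hx hy => [m a] [n b] /=; lia.
Qed.

Lemma chang_negD x y : ~~ chang_nneg x -> ~~ chang_nneg y -> ~~ chang_nneg (x + y).
Proof.
rewrite /chang_nneg => hx hy; have -> : x + y = chang_add x y by [].
rewrite /chang_add /chang_carry; case: eqP => [h|h]; rewrite chang_mk_val.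
  case: eqP => [e|_]; last by move: (\val x) (\val y) hx hy {h} => [m a] [n b] /=; lia.
  (* Only a double carry could lift two negative integer parts to 0; it would need [odot] of the
     second components to be the unit, hence each of them to be the unit. *)
  exfalso; case/eqP: (valP x); apply/mv_le_anti; first exact: mv_lex1.
  by rewrite -[X in mv_le X _]e; exact: mv_odot_le.
by case: eqP => _; move: (\val x) (\val y) hx hy {h} => [m a] [n b] /=; lia.
Qed.

Lemma chang_nneg_total x : chang_nneg x || chang_nneg (- x).
Proof.
rewrite /chang_nneg; have -> : - x = chang_opp x by [].
by rewrite /chang_opp chang_mk_val; case: eqP => _; move: (\val x) => [m a] /=; lia.
Qed.

Lemma chang_nnegMn x (n : nat) : (0 < n)%N -> chang_nneg (x *+ n) = chang_nneg x.
Proof.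
case: n => // n _; elim: n => [|n IH]; first by rewrite mulr1n.
rewrite mulrS; apply/idP/idP; last first.
  by move=> hx; apply: chang_nnegD => //; rewrite IH.
by apply: contraLR => hx; apply: chang_negD => //; rewrite IH.
Qed.

Lemma chang_nneg_anti x : chang_nneg x -> chang_nneg (- x) -> x = 0.
Proof.
rewrite /chang_nneg; have -> : - x = chang_opp x by [].
rewrite /chang_opp chang_mk_val; case: eqP => [e|_].
  move=> h1 h2; rewrite -[x]chang_mkK -[RHS]chang_inj0; congr chang_mk.
    by move: (\val x) h1 h2 {e} => [m a] /=; lia.
  by apply: star_inj; rewrite e.
by move: (\val x) => [m a] /=; lia.
Qed.

Lemma chang_inj_eq0 a : chang_inj a = 0 -> a = 0.
Proof.
move/(congr1 \val); rewrite -chang_inj0 !chang_mk_val [0 == _]eq_sym (negPf nt).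
by case: eqP => [_|_ []].
Qed.

Lemma chang_inj_le0 a : chang_nneg (- chang_inj a) -> a = 0.
Proof.
by move=> h; apply/chang_inj_eq0/chang_nneg_anti => //; exact: chang_inj_nneg.
Qed.

(** The delicate case is [a + b = one]: there [1 - a - b] is [- odot a b] in the group, and its
    nonnegativity forces [odot a b = 0]. Thus the sign of one form decides whether a sum is
    truncated. *)
Lemma chang_inj_orth a b :
  chang_nneg (chang_inj one - chang_inj a - chang_inj b) -> mv_le a (star b).
Proof.
move=> h; case: (altP (a + b =P one)) => [e|/mv_total_odot //].
apply: (proj1 (odot_eq0 _ _)); apply: chang_inj_le0; move: h.
by rewrite -addrA -opprD chang_injD1 // opprD addrA subrr add0r.
Qed.

Lemma chang_inj_orthN a b :
  ~~ chang_nneg (chang_inj one - chang_inj a - chang_inj b) -> a + b = one.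
Proof.
move=> h; apply/eqP/negPn/negP => /mv_total_odot /chang_injD e; case/negP: h.
by rewrite -addrA -opprD -e -chang_inj_star; exact: chang_inj_nneg.
Qed.

End Chang.

(** * Realizing a total cone of linear forms at a real point *)

(** Either list may be empty, and the separation is strict on both sides because strict signs have
    to be realized. *)
Lemma exists_between (R : realFieldType) (A B : seq R) :
  (forall a b, a \in A -> b \in B -> a < b) ->
  exists t, (forall a, a \in A -> a < t) /\ (forall b, b \in B -> t < b).
Proof.
have below : forall a, (forall b, b \in B -> a < b) ->
    exists2 t, a < t & forall b, b \in B -> t < b.
  elim: B => [|b B IH] a aB; first by exists (a + 1); rewrite ?ltrDl.
  have [c Bc|t at_ tB] := IH a; first by apply: aB; rewrite inE Bc orbT.
  have ab : a < b by apply: aB; rewrite inE eqxx.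
  exists (Num.min t ((a + b) / 2)).
    by rewrite lt_min at_ /=; lra.
  move=> c; rewrite inE => /orP[/eqP->|/tB tc]; rewrite gt_min ?tc //.
  by apply/orP; right; lra.
elim: A => [|a A IH] AB.
  have : exists a, forall b, b \in B -> a < b.
    elim: {below AB} B => [|b B [a aB]]; first by exists 0.
    exists (Num.min a (b - 1)) => c; rewrite inE => /orP[/eqP->|/aB h].
      by rewrite gt_min; apply/orP; right; lra.
    by rewrite gt_min h.
  by case=> a /below[t _ tB]; exists t.
have [b c bA cB|t [At tB]] := IH; first by apply: AB => //; rewrite inE bA orbT.
have aB b : b \in B -> a < b by move=> bB; apply: AB; rewrite ?inE ?eqxx.
have [ta|at_] := lerP t a.
  have [t' at' t'B] := below a aB; exists t'; split=> // c.
  by rewrite inE => /orP[/eqP-> //|/At ct]; apply: lt_trans ct (le_lt_trans ta at').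
by exists t; split=> // c; rewrite inE => /orP[/eqP->|/At].
Qed.

Section Realize.
Variables (K : realDomainType) (R : realFieldType) (phi : {rmorphism K -> R}).
Hypothesis phi_gt0 : forall k : K, 0 < k -> 0 < phi k.
Variable P : pred {poly K}.
Hypothesis P_total : forall c, P c || P (- c).
Hypothesis PD : forall c d, P c -> P d -> P (c + d).
Hypothesis PZ : forall (k : K) (c : {poly K}), 0 < k -> P (k *: c) = P c.
Implicit Types c d : {poly K}.

(** A polynomial encodes a homogeneous linear form, its [i]-th coefficient multiplying the [i]-th
    coordinate; the size then bounds the number of coordinates involved. *)
Definition form_at (n : nat) (x : nat -> R) c : R := \sum_(i < n) phi c`_i * x i.

Lemma form_atB n x c d : form_at n x (c - d) = form_at n x c - form_at n x d.
Proof.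
rewrite /form_at -sumrB; apply: eq_bigr => i _.
by rewrite coefB rmorphB mulrBl.
Qed.
Lemma form_atN n x c : form_at n x (- c) = - form_at n x c.
Proof.
rewrite /form_at -sumrN; apply: eq_bigr => i _.
by rewrite coefN rmorphN mulNr.
Qed.
Lemma form_atZ n x k c : form_at n x (k *: c) = phi k * form_at n x c.
Proof.
rewrite /form_at mulr_sumr; apply: eq_bigr => i _.
by rewrite coefZ rmorphM mulrA.
Qed.

(** Testing both [c] and [- c] distinguishes the signs positive, negative and zero. *)
Definition agree n x c : bool :=
  (P c == (0 <= form_at n x c)) && (P (- c) == (form_at n x c <= 0)).

Lemma agreeN n x c : agree n x (- c) = agree n x c.
Proof. by rewrite /agree opprK form_atN oppr_ge0 oppr_le0 andbC. Qed.

(* Fourier-Motzkin elimination of the last coordinate. *)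
Lemma cone_realize n (S : seq {poly K}) :
  (forall c, c \in S -> (size c <= n)%N) ->
  exists x, forall c, c \in S -> agree n x c.
Proof.
elim: n S => [|n IH] S hS.
  exists (fun=> 0) => c /hS; rewrite leqn0 size_poly_eq0 => /eqP->.
  have P0 : P 0 by have := P_total 0; rewrite oppr0 orbb.
  by rewrite /agree oppr0 P0 /form_at big_ord0 lexx.
(* Agreement is invariant under negation, so all forms involving the last coordinate are oriented to
   have a positive coefficient there. *)
pose T := [seq c : {poly K} <- S | 0 < c`_n] ++ [seq - c | c : {poly K} <- S & c`_n < 0].
have T_gt0 c : c \in T -> 0 < c`_n.
  rewrite mem_cat => /orP[|/mapP[d]]; rewrite mem_filter => /andP[] //.
  by move=> dn _ ->; rewrite coefN oppr_gt0.
have T_size c : c \in T -> (size c <= n.+1)%N.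
  rewrite mem_cat => /orP[|/mapP[d]]; rewrite mem_filter => /andP[_ /hS] //.
  by move=> h ->; rewrite size_polyN.
pose pair c d := d`_n *: c - c`_n *: d.
have [|x hx] := IH ([seq c : {poly K} <- S | c`_n == 0] ++ [seq pair c d | c <- T, d <- T]).
  have small c : (size c <= n.+1)%N -> c`_n = 0 -> (size c <= n)%N.
    move=> h cn; apply/leq_sizeP => i; rewrite leq_eqVlt => /orP[/eqP<- //|ni].
    by apply/leq_sizeP: i ni; exact: h.
  move=> c; rewrite mem_cat => /orP[|/allpairsP[[d e] /= [dT eT ->]]].
    by rewrite mem_filter => /andP[/eqP cn /hS h]; exact: small.
  apply: small; last by rewrite coefB !coefZ mulrC subrr.
  rewrite (leq_trans (size_polyD _ _)) // geq_max size_polyN.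
  by rewrite !(leq_trans (size_scale_leq _ _)) ?T_size.
pose l c := form_at n x c.
(* [r c] is the value of the last coordinate at which [c] vanishes over [x]. The combination
   [pair c d], free of that coordinate, records the comparison of two such roots. *)
pose r c := - l c / phi c`_n.
have pairP c d : c \in T -> d \in T -> P (pair c d) = (r c <= r d).
  move=> cT dT; have : agree n x (pair c d).
    by apply: hx; rewrite mem_cat; apply/orP; right; apply/allpairsP; exists (c, d).
  case/andP=> /eqP-> _; rewrite form_atB !form_atZ -/(l c) -/(l d).
  have := phi_gt0 (T_gt0 _ cT); have := phi_gt0 (T_gt0 _ dT).
  rewrite /r; set u := phi c`_n; set v := phi d`_n => v0 u0.
  by rewrite ler_pdivrMr // mulrAC ler_pdivlMr // subr_ge0 !mulNr lerN2
    mulrC [l c * _]mulrC.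
have low c d : c \in T -> d \in T -> P c -> P (- d) -> r c <= r d.
  move=> cT dT Pc Pd; rewrite -pairP // /pair -scalerN.
  by apply: PD; rewrite PZ ?T_gt0.
have lowN c d : c \in T -> d \in T -> P c -> ~~ P d -> r c < r d.
  move=> cT dT Pc Pd; rewrite ltNge -pairP //; apply: contra Pd => h.
  rewrite -(PZ _ (T_gt0 _ cT)); have -> : c`_n *: d = pair d c + d`_n *: c.
    by rewrite /pair subrK.
  by apply: PD => //; rewrite PZ ?T_gt0.
have upN c d : c \in T -> d \in T -> ~~ P (- c) -> P (- d) -> r c < r d.
  move=> cT dT Pc Pd; rewrite ltNge -pairP //; apply: contra Pc => h.
  rewrite -(PZ _ (T_gt0 _ dT)); have -> : d`_n *: - c = pair d c + c`_n *: - d.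
    by rewrite /pair !scalerN addrAC subrr add0r.
  by apply: PD => //; rewrite PZ ?T_gt0.
(* A form [e] with both [P e] and [P (- e)] must vanish, which forces [t = r e]. Without such a form
   the roots split into two classes, and [t] is taken strictly between them. *)
have [t ht] : exists t, forall c, c \in T -> (P c = (r c <= t)) /\ (P (- c) = (t <= r c)).
  have [/hasP[e eT /andP[Pe Pe']]|/hasPn noE] := boolP (has (fun c => P c && P (- c)) T).
    exists (r e) => c cT; split.
      apply/idP/idP => [h|]; first exact: low.
      by apply: contraTT => h; rewrite -ltNge; exact: lowN.
    apply/idP/idP => [h|]; first exact: low.
    by apply: contraTT => h; rewrite -ltNge; exact: upN.
  have [|t [tl tu]] := @exists_between _ [seq r c | c <- T & P c] [seq r c | c <- T & P (- c)].
    move=> _ _ /mapP[c + ->] /mapP[d + ->].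
    rewrite !mem_filter => /andP[Pc cT] /andP[Pd dT]; apply: lowN => //.
    by have := noE d dT; rewrite Pd andbT.
  exists t => c cT; have := noE c cT; have := P_total c.
  have cl : P c -> r c < t.
    by move=> h; apply: tl; apply/mapP; exists c => //; rewrite mem_filter h.
  have cu : P (- c) -> t < r c.
    by move=> h; apply: tu; apply/mapP; exists c => //; rewrite mem_filter h.
  case: (P c) cl => cl; case: (P (- c)) cu => cu //= _ _.
    by rewrite (ltW (cl isT)) leNgt (cl isT).
  by rewrite (ltW (cu isT)) leNgt (cu isT).
pose y i := if i == n then t else x i.
have formS c : form_at n.+1 y c = l c + phi c`_n * t.
  rewrite /form_at big_ord_recr /= {2}/y eqxx; congr (_ + _).
  by apply: eq_bigr => i _; rewrite /y ltn_eqF.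
have agreeT c : c \in T -> agree n.+1 y c.
  move=> cT; have [h1 h2] := ht c cT; have c0 := phi_gt0 (T_gt0 _ cT).
  rewrite /agree formS h1 h2 /r ler_pdivrMr // ler_pdivlMr // [t * _]mulrC.
  move: (_ * t) (l c) => u v.
  by apply/andP; split; apply/eqP; apply/idP/idP; lra.
exists y => c cS; have [cn|cn|cn] := ltrgt0P c`_n.
- by apply: agreeT; rewrite mem_cat mem_filter cn cS.
- rewrite -agreeN; apply: agreeT; rewrite mem_cat; apply/orP; right.
  by apply/mapP; exists c => //; rewrite mem_filter cn cS.
- rewrite /agree formS cn rmorph0 mul0r addr0; apply: hx.
  by rewrite mem_cat mem_filter cn eqxx cS.
Qed.

End Realize.

(** * Terms and completeness *)

(** The parameter [S] of scalar symbols lets one development serve both varieties: [void] for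
    MV-algebras and [{i01 R}] for Riesz MV-algebras. *)
Inductive term (S X : Type) : Type :=
| Var of X
| Zero
| Plus of term S X & term S X
| Star of term S X
| Scale of S & term S X.
Arguments Zero {S X}.

Section Eval.
Variables (S X : Type).
Implicit Type t : term S X.

Fixpoint teval (A : mvType) (act : S -> A -> A) (f : X -> A) t : A :=
  match t with
  | Var x => f x
  | Zero => 0
  | Plus t1 t2 => teval act f t1 + teval act f t2
  | Star t1 => star (teval act f t1)
  | Scale s t1 => act s (teval act f t1)
  end.

Fixpoint reval (R : realFieldType) (kap : S -> R) (rho : X -> R) t : R :=
  match t with
  | Var x => rho x
  | Zero => 0
  | Plus t1 t2 => Num.min 1 (reval kap rho t1 + reval kap rho t2)
  | Star t1 => 1 - reval kap rho t1
  | Scale s t1 => kap s * reval kap rho t1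
  end.

Fixpoint tvars t : seq X :=
  match t with
  | Var x => [:: x]
  | Zero => [::]
  | Plus t1 t2 => tvars t1 ++ tvars t2
  | Star t1 => tvars t1
  | Scale _ t1 => tvars t1
  end.

Lemma teval_hom (A B : mvType) (actA : S -> A -> A) (actB : S -> B -> B)
    (h : A -> B) (f : X -> A) t :
  mv_hom h -> (forall s a, h (actA s a) = actB s (h a)) ->
  h (teval actA f t) = teval actB (h \o f) t.
Proof.
move=> hh hs; elim: t => //= [|t1 <- t2 <-|t1 <-|s t1 <-] //.
- exact: mv_hom0.
- exact: mv_homD.
- exact: mv_hom_star.
Qed.

Definition tsub t1 t2 := Star (Plus (Star t1) t2).
Lemma teval_tsub (A : mvType) (act : S -> A -> A) (f : X -> A) t1 t2 :
  teval act f (tsub t1 t2) = mv_sub (teval act f t1) (teval act f t2).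
Proof. by rewrite mv_subE. Qed.

End Eval.

Section Linearize.
Variables (K : realDomainType) (R : realFieldType) (phi : {rmorphism K -> R}).
Hypothesis phi_gt0 : forall k : K, 0 < k -> 0 < phi k.
Variables (S : Type) (kap : S -> K).
Variables (C : mvType) (tot : mv_total C) (nt : mv_one C != 0).
Variable act : S -> C -> C.

Local Notation G := (chang_of tot nt).
Local Notation inj := (chang_inj tot nt).

(** Chang's group is not given as a [K]-module. So [E] is additive, a positive factor is only asked
    to preserve signs, and the scalar symbols are only constrained on forms whose value lies in the
    chain. *)
Definition linear_env (E : {poly K} -> G) : Prop :=
  [/\ forall c d, E (c - d) = E c - E d,
      forall (k : K) c, 0 < k -> chang_nneg (E (k *: c)) = chang_nneg (E c)
    & forall s a c, inj a = E c -> inj (act s a) = E (kap s *: c)].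

(* Each truncated sum is decided by the sign of one linear form, so on the cell
   cut out by the signs of the forms in [L] the term is the linear form [l]. *)
Lemma linearize (X : eqType) (E : {poly K} -> G) (f : X -> C) (l0 : X -> {poly K})
    (t : term S X) :
  linear_env E -> E 1 = inj (mv_one C) ->
  (forall x, x \in tvars t -> inj (f x) = E (l0 x)) ->
  exists l (L : seq {poly K}), inj (teval act f t) = E l /\
    forall v : {poly K} -> R,
      (forall c d, v (c - d) = v c - v d) ->
      (forall k c, v (k *: c) = phi k * v c) -> v 1 = 1 ->
      (forall c, c \in L -> chang_nneg (E c) = (0 <= v c)) ->
      reval (phi \o kap) (v \o l0) t = v l.
Proof.
move=> [EB EZ Eact] E1.
have E0 : E 0 = 0 by rewrite -[X in E X](subrr 0) EB subrr.
have ED c d : E (c + d) = E c + E d.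
  by rewrite -{1}[d]opprK EB -[- d]sub0r EB E0 sub0r opprK.
elim: t => [x|| t1 IH1 t2 IH2|t1 IH1|s t1 IH1] /= hx.
- by exists (l0 x), [::]; rewrite hx ?inE //; split.
- exists 0, [::]; rewrite E0; split=> // v vB _ _ _.
  by rewrite -[X in v X](subrr 0) vB subrr.
- have [|l1 [L1 [e1 h1]]] := IH1; first by move=> x xt; apply: hx; rewrite mem_cat xt.
  have [|l2 [L2 [e2 h2]]] := IH2; first by move=> x xt; apply: hx; rewrite mem_cat xt orbT.
  have sE : E (1 - l1 - l2)
      = inj (mv_one C) - inj (teval act f t1) - inj (teval act f t2).
    by rewrite !EB E1 e1 e2.
  exists (if chang_nneg (E (1 - l1 - l2)) then l1 + l2 else 1),
    ((1 - l1 - l2) :: L1 ++ L2); split.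
    rewrite sE; case: ifP => [/chang_inj_orth/(chang_injD tot nt)->|/negbT].
      by rewrite ED e1 e2.
    by move=> /chang_inj_orthN ->; rewrite E1.
  move=> v vB vZ v1 hL; rewrite hL ?inE ?eqxx // !vB v1.
  rewrite h1 ?h2 //; last 2 first.
  - by move=> c cL; apply: hL; rewrite inE mem_cat cL !orbT.
  - by move=> c cL; apply: hL; rewrite inE mem_cat cL !orbT.
  have v0 : v 0 = 0 by rewrite -[X in v X](subrr 0) vB subrr.
  have vD c d : v (c + d) = v c + v d.
    by rewrite -{1}[d]opprK vB -[- d]sub0r vB v0 sub0r opprK.
  case: ifP => h; first by rewrite vD; apply/min_idPr; lra.
  by rewrite v1; apply/min_idPl; move/negbT: h; lra.
- have [//|l1 [L1 [e1 h1]]] := IH1.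
  exists (1 - l1), L1; rewrite chang_inj_star // EB E1 e1; split=> // v vB vZ v1 hL.
  by rewrite vB v1 h1.
- have [//|l1 [L1 [e1 h1]]] := IH1.
  exists (kap s *: l1), L1; split; first exact: Eact.
  by move=> v vB vZ v1 hL; rewrite vZ h1.
Qed.

Lemma chain_complete (X : eqType) (f : X -> C) (t : term S X) :
  (forall (a : nat -> C) N, exists2 E : {poly K} -> G, linear_env E &
     forall i, (i < N)%N -> E 'X^i = inj (a i)) ->
  teval act f t <> 0 ->
  exists rho : X -> {i01 R}, 0 < reval (phi \o kap) (fun x => (rho x)%:num) t.
Proof.
(* Coordinate 0 is the unit and coordinates [1] to [size vs] are the variables of [t]. One further
   slot, of value 0, receives every variable absent from [t], since [index] then returns
   [size vs]. *)
move=> envE t0; pose vs := tvars t; pose N := (size vs).+2.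
pose a i := if i is j.+1 then nth 0 (map f vs) j else mv_one C.
have [E hE EX] := envE a N; case: (hE) => EB EZ _.
pose l0 x : {poly K} := 'X^((index x vs).+1).
have idx x : ((index x vs).+1 < N)%N by rewrite !ltnS index_size.
have E1 : E 1 = inj (mv_one C) by rewrite -(expr0 'X) EX.
have [x xt|l [L [el hl]]] := @linearize X E f l0 t hE E1.
  by rewrite /l0 EX //= (nth_map x) ?index_mem // nth_index.
have E0 : E 0 = 0 by rewrite -[X in E X](subrr 0) EB subrr.
have EN c : E (- c) = - E c by rewrite -sub0r EB E0 sub0r.
have ED c d : E (c + d) = E c + E d by rewrite -{1}[d]opprK EB EN opprK.
pose P : pred {poly K} := fun c => chang_nneg (E c).
(* The form [1] keeps the unit positive, [l] keeps the value of [t] positive, [L] keeps every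
   truncation decided as in the chain, and the last two families keep the coordinates between 0 and
   the unit. *)
pose Q := [:: 1; l] ++ L ++ [seq 'X^i | i <- iota 0 N] ++ [seq 1 - 'X^i | i <- iota 0 N].
have [|c d Pc Pd|k c k0|c cQ|x hx] := @cone_realize K R phi phi_gt0 P _ _ _
    (\max_(c <- Q) size c) Q.
- by move=> c; rewrite /P EN chang_nneg_total.
- by rewrite /P ED; apply: chang_nnegD.
- exact: EZ.
- by apply: (@leq_bigmax_seq _ _ predT (fun c : {poly K} => size c)).
set n := \max_(c <- Q) size c in hx; pose w := form_at phi n x.
have sgn c : c \in Q -> (P c = (0 <= w c)) * (P (- c) = (w c <= 0)).
  by move=> /hx /andP[/eqP-> /eqP->].
have w1 : 0 < w 1.
  rewrite ltNge -sgn ?inE ?eqxx // /P EN E1.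
  by apply/negP => /chang_inj_le0 e; case/eqP: nt.
have wP c : (0 <= w c / w 1) = (0 <= w c) by rewrite pmulr_lge0 ?invr_gt0.
(* Dividing by the value of the unit form turns the homogeneous solution into a point of the
   cube. *)
pose v c := w c / w 1.
have hr : reval (phi \o kap) (v \o l0) t = v l.
  apply: hl => [c d|k c||c cL]; rewrite /v ?divff ?gt_eqF //.
  - by rewrite /w form_atB mulrBl.
  - by rewrite /w form_atZ mulrA.
  - by rewrite wP -sgn // /Q !mem_cat cL orbT.
have v0 x' : 0 <= v (l0 x').
  rewrite /v wP -sgn; last first.
    rewrite /Q !mem_cat; do 2!(apply/orP; right); apply/orP; left.
    by apply/mapP; exists (index x' vs).+1 => //; rewrite mem_iota add0n idx.
  by rewrite /P /l0 EX ?idx // chang_inj_nneg.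
have v1 x' : v (l0 x') <= 1.
  rewrite /v ler_pdivrMr // mul1r -subr_ge0 -[X in 0 <= X](form_atB phi n x).
  rewrite -[form_at _ _ _ _]/(w _) -sgn; last first.
    rewrite /Q !mem_cat; do 3!(apply/orP; right).
    by apply/mapP; exists (index x' vs).+1 => //; rewrite mem_iota add0n idx.
  by rewrite /P EB E1 /l0 EX ?idx // -chang_inj_star // chang_inj_nneg.
exists (fun x' => Itv01 (v0 x') (v1 x')).
rewrite [X in 0 < X](_ : _ = reval (phi \o kap) (v \o l0) t) //.
rewrite hr /v pmulr_lgt0 ?invr_gt0 // ltNge -sgn ?inE ?eqxx ?orbT //.
by apply/negP; rewrite /P EN -el => /chang_inj_le0.
Qed.

End Linearize.

Definition void_act (A : Type) (s : void) : A -> A := match s with end.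

Section IntEnv.
Variables (C : mvType) (tot : mv_total C) (nt : mv_one C != 0).

(** Integer forms can be evaluated in any abelian group; a positive multiple keeps its sign because
    negative elements are closed under addition too. *)
Lemma int_linear_env (a : nat -> C) N :
  exists2 E : {poly int} -> chang_of tot nt,
    linear_env (of_void int) (@void_act C) E &
    forall i, (i < N)%N -> E 'X^i = chang_inj tot nt (a i).
Proof.
exists (fun c => \sum_(i < N) chang_inj tot nt (a i) *~ c`_i).
  split=> [c d|k c k0|[]].
    by rewrite -sumrB; apply: eq_bigr => i _; rewrite coefB mulrzBr.
  rewrite (_ : \sum_(i < N) _ = (\sum_(i < N) chang_inj tot nt (a i) *~ c`_i) *~ k).
    by case: k k0 => // n n0; rewrite -pmulrn chang_nnegMn.
  by rewrite mulrz_suml; apply: eq_bigr => i _; rewrite coefZ mulrC mulrzA.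
move=> i iN; rewrite (bigD1 (Ordinal iN)) //= coefXn eqxx mulr1z big1 ?addr0 //.
by move=> j; rewrite coefXn -val_eqE /= => /negPf->; rewrite mulr0z.
Qed.
End IntEnv.

(** * Real multiples in Chang's group of a Riesz chain *)

Section RealEnv.
Variables (R : realType) (C : rieszMVType R).
Variables (tot : mv_total C) (nt : mv_one C != 0).
Implicit Types (a b : C) (r q : R) (s : {i01 R}).

Local Notation inj := (chang_inj tot nt).
Local Notation G := (chang_of tot nt).

Lemma clip01_ge0 r : 0 <= Num.max 0 (Num.min 1 r).
Proof. by rewrite le_max lexx. Qed.
Lemma clip01_le1 r : Num.max 0 (Num.min 1 r) <= 1.
Proof. by rewrite ge_max ler01 ge_min lexx. Qed.
Definition clip01 r : {i01 R} := Itv01 (clip01_ge0 r) (clip01_le1 r).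

Lemma clip01K r : 0 <= r <= 1 -> (clip01 r)%:num = r.
Proof. by case/andP=> r0 r1 /=; rewrite (min_idPr r1) (max_idPr r0). Qed.

Lemma clip01_num s : clip01 s%:num = s.
Proof. by apply: val_inj; rewrite [LHS]clip01K // ge0 le1. Qed.

(** The subtraction axiom for scalars exhibits [r a] as the difference of [(r + q) a] and [q a];
    these are comparable, so the difference can be undone. *)
Lemma scal_clip01D r q a : 0 <= r -> 0 <= q -> r + q <= 1 ->
  inj (scal (clip01 (r + q)) a) = inj (scal (clip01 r) a) + inj (scal (clip01 q) a).
Proof.
move=> r0 q0 rq; have rq1 : 0 <= r + q <= 1 by rewrite rq addr_ge0.
have r1 : 0 <= r <= 1 by rewrite r0; lra.
have q1 : 0 <= q <= 1 by rewrite q0; lra.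
have e : scal (clip01 r) a = mv_sub (scal (clip01 (r + q)) a) (scal (clip01 q) a).
  by apply: scal_subE; rewrite !clip01K // addrK; apply/esym/max_idPl.
rewrite -chang_injD //; first congr inj.
  rewrite e mv_subK //; apply: scal0_le; rewrite !clip01K //; lra.
by rewrite e /mv_sub odotC; exact: mv_odot_le.
Qed.

(** The real multiple [r a]: integer multiples come from the group, the fractional part from the
    scalars of the chain. *)
Definition real_mul r a : G :=
  inj a *~ Num.floor r + inj (scal (clip01 (r - (Num.floor r)%:~R)) a).

Lemma scal_clip0 a : scal (clip01 0) a = 0.
Proof.
rewrite -(mv_subxx (scal (clip01 0) a)); apply: scal_subE.
by rewrite subrr maxxx clip01K // lexx ler01.
Qed.

Lemma scal_clip1 a : scal (clip01 1) a = a.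
Proof.
rewrite -[RHS]scal1; congr scal; apply: val_inj.
by rewrite [LHS]clip01K // lexx ler01.
Qed.

(** The endpoint [q = 1], where the floor jumps to [k + 1], is included; additivity can then use
    decompositions that are not the canonical ones. *)
Lemma real_mulE (k : int) q a : 0 <= q <= 1 ->
  real_mul (k%:~R + q) a = inj a *~ k + inj (scal (clip01 q) a).
Proof.
case/andP=> q0; rewrite le_eqVlt => /orP[/eqP->|q1]; rewrite /real_mul.
  have -> : Num.floor (k%:~R + 1 : R) = k + 1.
    by apply: floor_def; rewrite !intrD lexx ltrDl ltr01.
  rewrite intrD subrr scal_clip0 scal_clip1 chang_inj0 addr0.
  by rewrite mulrzDr mulr1z.
have -> : Num.floor (k%:~R + q) = k.
  by apply: floor_def; rewrite intrD lerDl q0 ltrD2l.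
by rewrite addrAC subrr add0r.
Qed.

Lemma real_mul01 s a : real_mul s%:num a = inj (scal s a).
Proof.
rewrite -[s%:num]add0r (@real_mulE 0) ?ge0 ?le1 //.
by rewrite mulr0z add0r clip01_num.
Qed.

Lemma real_mulD r q a : real_mul (r + q) a = real_mul r a + real_mul q a.
Proof.
have dec (x : R) : exists (k : int) (y : R), [/\ x = k%:~R + y, 0 <= y & y <= 1].
  exists (Num.floor x), (x - (Num.floor x)%:~R); split.
  - by rewrite addrC subrK.
  - by rewrite subr_ge0 floor_le.
  - by have := ltW (floorD1_gt x); rewrite intrD lerBlDl.
have [k [y [-> y0 y1]]] := dec r; have [l [z [-> z0 z1]]] := dec q.
rewrite addrACA -intrD !(@real_mulE k, @real_mulE l) ?y0 ?z0 // addrACA -mulrzDr.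
have [yz|yz] := lerP (y + z) 1.
  by rewrite real_mulE ?addr_ge0 // scal_clip01D.
have -> : (k + l)%:~R + (y + z) = (k + l + 1)%:~R + (y + z - 1) :> R.
  by rewrite [in RHS]intrD; ring.
rewrite real_mulE; last by apply/andP; split; lra.
rewrite mulrzDr mulr1z -addrA; congr (_ + _).
(* The fractional parts carry: [y = (1 - z) + (y + z - 1)] and [1 = (1 - z) + z] are sums of scalars
   staying in [[0,1]], where additivity is known. *)
have -> : inj (scal (clip01 y) a)
    = inj (scal (clip01 (1 - z)) a) + inj (scal (clip01 (y + z - 1)) a).
  by rewrite -scal_clip01D; [congr (inj (scal (clip01 _) _)); ring|lra..].
have -> : inj a = inj (scal (clip01 (1 - z)) a) + inj (scal (clip01 z) a).
  by rewrite -scal_clip01D; [rewrite subrK scal_clip1|lra..].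
by rewrite [LHS]addrAC.
Qed.

Lemma real_mul0 a : real_mul 0 a = 0.
Proof. by apply: (@addrI _ (real_mul 0 a)); rewrite -real_mulD !addr0. Qed.
Lemma real_mulN r a : real_mul (- r) a = - real_mul r a.
Proof. by apply: (@addrI _ (real_mul r a)); rewrite -real_mulD !subrr real_mul0. Qed.
Lemma real_mulMn r a n : real_mul (r *+ n) a = real_mul r a *+ n.
Proof.
by elim: n => [|n IH]; rewrite ?mulr0n ?real_mul0 // !mulrS real_mulD IH.
Qed.
Lemma real_mulMz r a (k : int) : real_mul (r *~ k) a = real_mul r a *~ k.
Proof.
by case: k => n; rewrite ?NegzE ?mulrNz -!pmulrn ?real_mulN real_mulMn.
Qed.

Definition chang_scal s (g : G) : G :=
  inj (scal s (mv_one C)) *~ (\val g).1 + inj (scal s (\val g).2).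

Lemma chang_scal_mk s (m : int) a :
  chang_scal s (chang_mk tot nt m a) = inj (scal s (mv_one C)) *~ m + inj (scal s a).
Proof.
rewrite /chang_scal chang_mk_val; case: eqP => [->|] //=.
by rewrite scal_0 chang_inj0 addr0 mulrzDr mulr1z.
Qed.

Lemma scal_orth s a b : mv_le a (star b) -> mv_le (scal s a) (star (scal s b)).
Proof.
move=> h; apply: mv_le_trans (scal_le_id _ _) _; apply: mv_le_trans h _.
exact/mv_le_star/scal_le_id.
Qed.

Lemma chang_scalD s x y : chang_scal s (x + y) = chang_scal s x + chang_scal s y.
Proof.
rewrite -[x]chang_mkK -[y]chang_mkK; move: (\val x) (\val y) => [m a] [n b] /=.
rewrite [_ + chang_mk _ _ n b]chang_addE /chang_carry !chang_scal_mk addrACA -mulrzDr.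
case: (altP (a + b =P mv_one C)) => h; rewrite chang_scal_mk; last first.
  have o := mv_total_odot tot h.
  by rewrite scal_addr // chang_injD //; exact: scal_orth.
rewrite mulrzDr mulr1z -addrA; congr (_ + _).
(* In the carry case, [a = odot a b + star b] and [one = b + star b] are both orthogonal sums, on
   which scalars are additive. *)
have ba : mv_le (star b) a by apply/mv_leE; rewrite starK addrC.
have ob : mv_le (odot a b) (star (star b)) by rewrite starK odotC; exact: mv_odot_le.
have aE : odot a b + star b = a by rewrite -{2}(mv_subK ba) /mv_sub starK.
have -> : inj (scal s a) = inj (scal s (odot a b)) + inj (scal s (star b)).
  by rewrite -{1}aE scal_addr // chang_injD //; exact: scal_orth.
have -> : inj (scal s (mv_one C)) = inj (scal s b) + inj (scal s (star b)).
  have o : mv_le b (star (star b)) by rewrite starK; exact: mv_lexx.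
  by rewrite -(mv_addN b) scal_addr // chang_injD //; exact: scal_orth.
by rewrite -[LHS]addrA addrC [inj (scal s (star b)) + _]addrC.
Qed.

Lemma chang_scal_sum s (I : finType) (F : I -> G) :
  chang_scal s (\sum_i F i) = \sum_i chang_scal s (F i).
Proof.
have h0 : chang_scal s 0 = 0 by apply: (@addrI _ (chang_scal s 0)); rewrite -chang_scalD !addr0.
exact: (big_morph _ (chang_scalD s) h0).
Qed.

Lemma chang_scal_inj s a : chang_scal s (inj a) = inj (scal s a).
Proof. by rewrite chang_scal_mk mulr0z add0r. Qed.

Lemma chang_scalMz s x (k : int) : chang_scal s (x *~ k) = chang_scal s x *~ k.
Proof.
have h0 : chang_scal s 0 = 0 by apply: (@addrI _ (chang_scal s 0)); rewrite -chang_scalD !addr0.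
have hn n : chang_scal s (x *+ n) = chang_scal s x *+ n.
  by elim: n => [|n IH]; rewrite ?mulr0n // !mulrS chang_scalD IH.
have hN y : chang_scal s (- y) = - chang_scal s y.
  by apply: (@addrI _ (chang_scal s y)); rewrite -chang_scalD !subrr.
by case: k => n; rewrite ?NegzE ?mulrNz -!pmulrn ?hN hn.
Qed.

Lemma chang_scal_mul s r a : chang_scal s (real_mul r a) = real_mul (s%:num * r) a.
Proof.
rewrite {1}/real_mul chang_scalD chang_scalMz !chang_scal_inj.
set k := Num.floor r; set q := r - _.
have q01 : 0 <= q <= 1.
  rewrite /q subr_ge0 floor_le /=; have := ltW (floorD1_gt r); rewrite intrD -/k; lra.
have -> : s%:num * r = s%:num *~ k + s%:num * q by rewrite /q -mulrzr; ring.
rewrite real_mulD real_mulMz real_mul01; congr (_ + _).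
have sq01 : 0 <= s%:num * q <= 1.
  by case/andP: q01 => q0 q1; rewrite mulr_ge0 //= mulr_ile1.
by rewrite -(@scal_mulE _ _ (clip01 (s%:num * q))) ?clip01K // -real_mul01 clip01K.
Qed.

Lemma chang_scal_nneg s x : chang_nneg x -> chang_nneg (chang_scal s x).
Proof.
rewrite {1}/chang_nneg /chang_scal => h; apply: chang_nnegD; last exact: chang_inj_nneg.
case: (\val x).1 h => [[|n]|n] // _.
  by rewrite mulr0z -(chang_inj0 tot nt) chang_inj_nneg.
by rewrite -pmulrn chang_nnegMn // chang_inj_nneg.
Qed.

(** Signs under a positive real factor [r] are handled by [r = n (r / n)] with [r / n] in [[0,1]]:
    scalars and natural multiples preserve nonnegativity, and the factor [k^-1] gives the
    converse. *)
Lemma real_linear_env (a : nat -> C) N :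
  exists2 E : {poly R} -> G,
    linear_env (fun s : {i01 R} => s%:num) scal E &
    forall i, (i < N)%N -> E 'X^i = inj (a i).
Proof.
pose E (c : {poly R}) : G := \sum_(i < N) real_mul c`_i (a i).
have EM s c : E (s%:num *: c) = chang_scal s (E c).
  by rewrite /E chang_scal_sum; apply: eq_bigr => i _; rewrite coefZ chang_scal_mul.
have En c n : E (n%:R *: c) = E c *+ n.
  rewrite /E -sumrMnl; apply: eq_bigr => i _.
  by rewrite coefZ mulr_natl real_mulMn.
exists E; last first.
  move=> i iN; rewrite /E (bigD1 (Ordinal iN)) //= coefXn eqxx big1 ?addr0.
    have -> : (1 : R) = (1%:i01 : {i01 R})%:num by [].
    by rewrite real_mul01 scal1.
  by move=> j; rewrite coefXn -val_eqE /= => /negPf->; rewrite real_mul0.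
split=> [c d|k c k0|s x c h]; last by rewrite EM -h chang_scal_inj.
  by rewrite /E -sumrB; apply: eq_bigr => i _; rewrite coefB real_mulD real_mulN.
have half r e : 0 < r -> chang_nneg (E e) -> chang_nneg (E (r *: e)).
  move=> r0 he; pose n := (Num.truncn r).+1.
  have rn : r < n%:R := truncnS_gt r.
  have n0 : 0 < n%:R :> R by rewrite ltr0n.
  have -> : r *: e = n%:R *: ((clip01 (r / n%:R))%:num *: e).
    rewrite scalerA clip01K; first by rewrite mulrCA divff ?mulr1 // gt_eqF.
    apply/andP; split; first by apply: divr_ge0; exact: ltW.
    by rewrite ler_pdivrMr // mul1r ltW.
  by rewrite En chang_nnegMn // EM; exact: chang_scal_nneg.
apply/idP/idP; last exact: half.
by move=> /(half k^-1); rewrite scalerA mulVf ?gt_eqF // scale1r invr_gt0; apply.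
Qed.

End RealEnv.

Lemma mv_one_neq0 (A : mvType) (a : A) : a <> 0 -> mv_one A != 0.
Proof. by move=> h; apply/eqP => e; apply: h; apply: mv_le0; rewrite -e; exact: mv_lex1. Qed.

(** A nonzero value survives in the quotient by a prime ideal missing it, and that quotient is a
    nontrivial chain. *)
Lemma mv_completeness (R : realType) (X : Type) (A : mvType) (f : X -> A)
    (t : term void X) : teval (@void_act A) f t <> 0 ->
  exists rho : X -> {i01 R}, 0 < reval (of_void R) (fun x => (rho x)%:num) t.
Proof.
move=> t0; have [I [hI It Ipr]] := mv_prime_ideal t0.
have tot := mvquot_total (hI := hI) Ipr; have pih := mvpi_hom hI.
have pt0 : teval (@void_act (mvquot hI)) (mvpi hI \o f) t <> 0.
  by rewrite -(teval_hom (actA := @void_act A) _ _ pih) => [/mvpi_eq0|[]].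
have nt := mv_one_neq0 pt0.
have h0 (k : int) : 0 < k -> 0 < (k%:~R : R) by rewrite ltr0z.
have [rho h] := @chain_complete int R intr h0 void (of_void int) _ tot nt
  (@void_act (mvquot hI)) {classic X} (mvpi hI \o f) t (int_linear_env tot nt) pt0.
by exists rho; rewrite (_ : of_void R = intr \o of_void int) //; apply/funext => -[].
Qed.

Lemma riesz_completeness (R : realType) (X : Type) (V : rieszMVType R) (f : X -> V)
    (t : term {i01 R} X) : teval scal f t <> 0 ->
  exists rho : X -> {i01 R},
    0 < reval (fun s : {i01 R} => s%:num) (fun x => (rho x)%:num) t.
Proof.
move=> t0; have [I [hI It Ipr]] := mv_prime_ideal t0.
have tot : mv_total (rquot hI) := mvquot_total Ipr.
have [pih pis] := rpi_hom hI.
have pt0 : teval scal (rpi hI \o f) t <> 0.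
  by rewrite -(teval_hom _ _ pih pis) => /mvpi_eq0.
have nt := mv_one_neq0 pt0.
exact: (@chain_complete R R idfun (fun k => id) {i01 R} (fun s => s%:num) _ tot nt
  scal {classic X} (rpi hI \o f) t (real_linear_env tot nt) pt0).
Qed.

(** * Algebras of [0,1]-valued functions *)

Ltac minmax_lra := rewrite /=;
  repeat match goal with
  | |- context [Order.min ?a ?b] => case: (leP a b)
  | |- context [Order.max ?a ?b] => case: (leP a b)
  end; intros; lra.

Section Fun01.
Variables (R : realType) (Y : Type).

Definition fun01 : Type := {f : Y -> R | `[< forall y, 0 <= f y <= 1 >]}.
HB.instance Definition _ := SubChoice.on fun01.
Implicit Types a b c : fun01.

Definition fun01_mk (f : Y -> R) (hf : forall y, 0 <= f y <= 1) : fun01 :=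
  exist _ f (asboolT hf).

Lemma fun01P a y : 0 <= \val a y <= 1.
Proof. by have /asboolP := valP a; apply. Qed.
Lemma fun01_ge0 a y : 0 <= \val a y. Proof. by case/andP: (fun01P a y). Qed.
Lemma fun01_le1 a y : \val a y <= 1. Proof. by case/andP: (fun01P a y). Qed.

Lemma fun01_eqP a b : (forall y, \val a y = \val b y) -> a = b.
Proof. by move=> h; apply: val_inj; apply/funext. Qed.

Lemma fun01_zero_subproof (y : Y) : 0 <= (0 : R) <= 1.
Proof. by rewrite lexx ler01. Qed.
Lemma fun01_add_subproof a b y : 0 <= Num.min 1 (\val a y + \val b y) <= 1.
Proof. by have := fun01_ge0 a y; have := fun01_ge0 b y; minmax_lra. Qed.
Lemma fun01_neg_subproof a y : 0 <= 1 - \val a y <= 1.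
Proof. by have /andP[] := fun01P a y; lra. Qed.
Lemma fun01_scal_subproof (r : {i01 R}) a y : 0 <= r%:num * \val a y <= 1.
Proof.
have /andP[h0 h1] := fun01P a y.
by apply/andP; split; [exact: mulr_ge0 | exact: mulr_ile1].
Qed.

Definition fun01_zero := fun01_mk fun01_zero_subproof.
Definition fun01_add a b := fun01_mk (fun01_add_subproof a b).
Definition fun01_neg a := fun01_mk (fun01_neg_subproof a).
Definition fun01_scal (r : {i01 R}) a := fun01_mk (fun01_scal_subproof r a).

Lemma fun01_addC : commutative fun01_add.
Proof. by move=> a b; apply: fun01_eqP => y /=; rewrite addrC. Qed.
Lemma fun01_addA : associative fun01_add.
Proof.
move=> a b c; apply: fun01_eqP => y /=.
by have := fun01_ge0 a y; have := fun01_ge0 c y; minmax_lra.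
Qed.
Lemma fun01_add0 : left_id fun01_zero fun01_add.
Proof. by move=> a; apply: fun01_eqP => y /=; have := fun01_le1 a y; minmax_lra. Qed.

HB.instance Definition _ :=
  GRing.isNmodule.Build fun01 fun01_addA fun01_addC fun01_add0.

Lemma fun01_negK a : fun01_neg (fun01_neg a) = a.
Proof. by apply: fun01_eqP => y /=; lra. Qed.
Lemma fun01_neg0D a : fun01_neg 0 + a = fun01_neg 0.
Proof. by apply: fun01_eqP => y /=; have := fun01_ge0 a y; minmax_lra. Qed.
Lemma fun01_negDC a b :
  fun01_neg (fun01_neg a + b) + b = fun01_neg (fun01_neg b + a) + a.
Proof.
apply: fun01_eqP => y /=.
by have /andP[] := fun01P a y; have /andP[] := fun01P b y; minmax_lra.
Qed.

HB.instance Definition _ := isMVAlgebra.Build fun01 fun01_negK fun01_neg0D fun01_negDC.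

Lemma fun01_0E y : \val (0 : fun01) y = 0. Proof. by []. Qed.
Lemma fun01_DE a b y : \val (a + b) y = Num.min 1 (\val a y + \val b y).
Proof. by []. Qed.
Lemma fun01_starE a y : \val (star a) y = 1 - \val a y. Proof. by []. Qed.
Lemma fun01_1E y : \val (mv_one fun01) y = 1. Proof. exact: subr0. Qed.
Lemma fun01_odotE a b y : \val (odot a b) y = Num.max 0 (\val a y + \val b y - 1).
Proof. by rewrite /odot !(fun01_starE, fun01_DE); minmax_lra. Qed.
Lemma fun01_subE a b y : \val (mv_sub a b) y = Num.max 0 (\val a y - \val b y).
Proof. by rewrite /mv_sub fun01_odotE fun01_starE; congr Num.max; ring. Qed.
Lemma fun01_MnE a n y : \val (a *+ n) y = Num.min 1 (\val a y *+ n).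
Proof.
elim: n => [|n IH]; first by rewrite !mulr0n fun01_0E; minmax_lra.
rewrite !mulrS fun01_DE IH; have := fun01_ge0 a y.
move: (_ *+ n) => u; minmax_lra.
Qed.

Lemma fun01_leP a b : mv_le a b <-> forall y, \val a y <= \val b y.
Proof.
rewrite /mv_le -/(mv_sub a b); split=> [h y|h].
  by have := fun01_subE a b y; rewrite h fun01_0E; minmax_lra.
by apply: fun01_eqP => y; rewrite fun01_subE fun01_0E; have := h y; minmax_lra.
Qed.

Lemma fun01_scalE_odot r a b :
  fun01_scal r (odot a (star b)) = odot (fun01_scal r a) (star (fun01_scal r b)).
Proof.
have sE c y : \val (fun01_scal r c) y = r%:num * \val c y by [].
apply: fun01_eqP => y; rewrite -!/(mv_sub _ _) fun01_subE !sE fun01_subE.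
by rewrite maxr_pMr // mulr0 mulrBr.
Qed.
Lemma fun01_scalE_sub (r q : {i01 R}) a :
  fun01_scal (Num.max (r%:num - q%:num) 0)%:i01 a
  = odot (fun01_scal r a) (star (fun01_scal q a)).
Proof.
have sE s c y : \val (fun01_scal s c) y = s%:num * \val c y by [].
apply: fun01_eqP => y; rewrite -!/(mv_sub _ _) fun01_subE !sE.
by rewrite maxr_pMl ?fun01_ge0 // mul0r mulrBl maxC.
Qed.
Lemma fun01_scalEM (r q : {i01 R}) a :
  fun01_scal (r%:num * q%:num)%:i01 a = fun01_scal r (fun01_scal q a).
Proof. by apply: fun01_eqP => y /=; rewrite mulrA. Qed.
Lemma fun01_scalE1 a : fun01_scal 1%:i01 a = a.
Proof. by apply: fun01_eqP => y /=; rewrite mul1r. Qed.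

HB.instance Definition _ := MVAlgebra_isRiesz.Build R fun01
  fun01_scalE_odot fun01_scalE_sub fun01_scalEM fun01_scalE1.

Lemma fun01_scalE (r : {i01 R}) a y : \val (scal r a) y = r%:num * \val a y.
Proof. by []. Qed.

Lemma fun01_teval (S X : Type) (act : S -> fun01 -> fun01) (kap : S -> R)
    (f : X -> fun01) (t : term S X) y :
  (forall s a, \val (act s a) y = kap s * \val a y) ->
  \val (teval act f t) y = reval kap (fun x => \val (f x) y) t.
Proof.
move=> h; elim: t => //= [t1 IH1 t2 IH2|t1 IH1|s t1 IH1].
- by rewrite -IH1 -IH2.
- by rewrite -IH1.
- by rewrite -IH1 -h.
Qed.

End Fun01.

(** * Term functions on the cube and a criterion for freeness *)

Section Generation.
Variables (R : realType) (X : Type).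

(** The term values form a subalgebra containing the generators. Freeness maps [F] into it, and by
    uniqueness the composite with the inclusion is the identity of [F]. *)
Lemma free_mv_gen (F : mvType) (i : X -> F) : free_mv i ->
  forall a, exists t, a = teval (@void_act F) i t.
Proof.
move=> hF; pose Sset : set F := [set a | exists t, a = teval (@void_act F) i t].
have S0 : Sset 0 by exists Zero.
have SD a b : Sset a -> Sset b -> Sset (a + b).
  by move=> [t ->] [t' ->]; exists (Plus t t').
have Ss a : Sset a -> Sset (star a) by move=> [t ->]; exists (Star t).
pose S := MVSub S0 SD Ss.
have Si x : mvsub_set S (i x) by exists (Var _ x).
have [r [[rh ri] _]] := hF (mvsub_sort S) (fun x => mvsub_mk (Si x)).
have [k [_ kU]] := hF F i.
have e1 : k = id by apply: kU; split.
have e2 : k = (fun a => \val (r a)).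
  apply: kU; split=> [|x]; last by rewrite ri.
  by case: rh => r0 rD rs; split=> [|a b|a] /=; rewrite ?r0 ?rD ?rs.
move=> a; have : k a = \val (r a) by rewrite e2.
by rewrite e1 => ->; exact: (mvsub_valP (r a)).
Qed.

Lemma free_rmv_gen (V : rieszMVType R) (j : X -> V) : free_rmv j ->
  forall a, exists t, a = teval scal j t.
Proof.
move=> hV; pose Sset : set V := [set a | exists t, a = teval scal j t].
have S0 : Sset 0 by exists Zero.
have SD a b : Sset a -> Sset b -> Sset (a + b).
  by move=> [t ->] [t' ->]; exists (Plus t t').
have Ss a : Sset a -> Sset (star a) by move=> [t ->]; exists (Star t).
have Sc s a : Sset a -> Sset (scal s a) by move=> [t ->]; exists (Scale s t).
pose S := RieszSub (rsub_mv := MVSub S0 SD Ss) Sc.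
have Sj x : mvsub_set S (j x) by exists (Var _ x).
have [r [[[rh rs] rj] _]] := hV (rsub_sort S) (fun x => mvsub_mk (Sj x)).
have [k [_ kU]] := hV V j.
have e1 : k = id by apply: kU; split.
have e2 : k = (fun a => \val (r a)).
  apply: kU; split=> [|x]; last by rewrite rj.
  split; last by move=> s a; rewrite rs.
  by case: rh => r0 rD rst; split=> [|a b|a] /=; rewrite ?r0 ?rD ?rst.
move=> a; have : k a = \val (r a) by rewrite e2.
by rewrite e1 => ->; exact: (mvsub_valP (r a)).
Qed.

Local Notation Y := (X -> {i01 R}).

(** The coordinate is written as the scalar [p x] times the unit over a one-point set, so that its
    bounds are those of scalar multiplication. *)
Definition proj (x : X) : fun01 R Y :=
  fun01_mk (fun p : Y => fun01_scal_subproof (p x) (mv_one (fun01 R unit)) tt).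

Lemma projE x p : \val (proj x) p = (p x)%:num.
Proof. by rewrite /= subr0 mulr1. Qed.

Definition mvfun (t : term void X) : fun01 R Y := teval (@void_act _) proj t.
Definition rmvfun (t : term {i01 R} X) : fun01 R Y := teval scal proj t.

Lemma mvfunE t p : \val (mvfun t) p = reval (of_void R) (fun x => (p x)%:num) t.
Proof.
rewrite (@fun01_teval _ _ _ _ _ (of_void R)) => [|[]].
by congr (reval _ _ t); apply/funext => x; rewrite projE.
Qed.

Lemma rmvfunE t p : \val (rmvfun t) p
  = reval (fun s : {i01 R} => s%:num) (fun x => (p x)%:num) t.
Proof.
rewrite (@fun01_teval _ _ _ _ _ (fun s : {i01 R} => s%:num)) //.
by congr (reval _ _ t); apply/funext => x; rewrite projE.
Qed.

Lemma mvfun_eq (A : mvType) (f : X -> A) t1 t2 :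
  mvfun t1 = mvfun t2 -> teval (@void_act A) f t1 = teval (@void_act A) f t2.
Proof.
have half u1 u2 : mvfun u1 = mvfun u2 ->
    mv_sub (teval (@void_act A) f u1) (teval (@void_act A) f u2) = 0.
  move=> e; apply: contrapT; rewrite -teval_tsub.
  move=> /(@mv_completeness R _ _ _ _) [p]; rewrite -mvfunE /mvfun teval_tsub.
  by rewrite -!/(mvfun _) e mv_subxx fun01_0E ltxx.
by move=> e; apply: mv_sub_eq0; apply: half.
Qed.

Lemma rmvfun_eq (V : rieszMVType R) (f : X -> V) t1 t2 :
  rmvfun t1 = rmvfun t2 -> teval scal f t1 = teval scal f t2.
Proof.
have half u1 u2 : rmvfun u1 = rmvfun u2 ->
    mv_sub (teval scal f u1) (teval scal f u2) = 0.
  move=> e; apply: contrapT; rewrite -teval_tsub.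
  move=> /(@riesz_completeness R _ _ _ _) [p]; rewrite -rmvfunE /rmvfun teval_tsub.
  by rewrite -!/(rmvfun _) e mv_subxx fun01_0E ltxx.
by move=> e; apply: mv_sub_eq0; apply: half.
Qed.

Lemma free_mv_embed (F : mvType) (i : X -> F) : free_mv i ->
  exists h : F -> fun01 R Y, mv_embedding h /\
    forall t, h (teval (@void_act F) i t) = mvfun t.
Proof.
move=> hF; have [h [[hh hi] _]] := hF _ proj.
have ht t : h (teval (@void_act F) i t) = mvfun t.
  rewrite (teval_hom (actB := @void_act _) _ _ hh) => [|[]].
  by congr teval; apply/funext => x; exact: hi.
exists h; split=> //; split=> // a b.
have [t ->] := free_mv_gen hF a; have [t' ->] := free_mv_gen hF b.
by rewrite !ht; exact: mvfun_eq.
Qed.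

Lemma free_rmv_embed (V : rieszMVType R) (j : X -> V) : free_rmv j ->
  exists h : V -> fun01 R Y, [/\ riesz_hom h, injective h &
    forall t, h (teval scal j t) = rmvfun t].
Proof.
move=> hV; have [h [[[hh hs] hj] _]] := hV _ proj.
have ht t : h (teval scal j t) = rmvfun t.
  rewrite (teval_hom _ _ hh hs).
  by congr teval; apply/funext => x; exact: hj.
exists h; split=> // a b.
have [t ->] := free_rmv_gen hV a; have [t' ->] := free_rmv_gen hV b.
by rewrite !ht; exact: rmvfun_eq.
Qed.

(** A chosen term [code a] represents each [a], and a map on generators is extended by evaluating
    that term. The choice is harmless: terms with equal values in [F] have equal functions on the
    cube, hence equal values everywhere by [mvfun_eq]. *)
Lemma free_mv_crit (F : mvType) (i : X -> F) (h : F -> fun01 R Y) :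
  mv_hom h -> (forall x, h (i x) = proj x) ->
  (forall a, exists t, a = teval (@void_act F) i t) -> free_mv i.
Proof.
move=> hh hi gen B f.
have [code codeP] := choice gen.
have gE t : teval (@void_act B) f (code (teval (@void_act F) i t))
    = teval (@void_act B) f t.
  apply: mvfun_eq; rewrite /mvfun (_ : proj = h \o i); last first.
    by apply/funext => x; rewrite /= hi.
  rewrite -!(teval_hom (actA := @void_act _) _ _ hh) -?codeP //; by case.
exists (fun a => teval (@void_act B) f (code a)); split; first split.
- split.
  + exact: (gE Zero).
  + by move=> a b; rewrite {1}[a]codeP {1}[b]codeP; exact: (gE (Plus _ _)).
  + by move=> a; rewrite {1}[a]codeP; exact: (gE (Star _)).
- by move=> x; exact: (gE (Var _ x)).
move=> g [gh gi]; apply/funext => a; rewrite [in RHS](codeP a).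
rewrite (teval_hom (actB := @void_act _) _ _ gh) => [|[]].
by congr teval; apply/funext => x; rewrite /= gi.
Qed.

Lemma free_rmv_crit (V : rieszMVType R) (j : X -> V) (h : V -> fun01 R Y) :
  riesz_hom h -> (forall x, h (j x) = proj x) ->
  (forall a, exists t, a = teval scal j t) -> free_rmv j.
Proof.
move=> [hh hs] hj gen B f.
have [code codeP] := choice gen.
have gE t : teval scal f (code (teval scal j t)) = teval scal f t.
  apply: rmvfun_eq; rewrite /rmvfun (_ : proj = h \o j); last first.
    by apply/funext => x; rewrite /= hj.
  by rewrite -!(teval_hom _ _ hh hs) -codeP.
exists (fun a => teval scal f (code a)); split; first split.
- split; first split.
  + exact: (gE Zero).
  + by move=> a b; rewrite {1}[a]codeP {1}[b]codeP; exact: (gE (Plus _ _)).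
  + by move=> a; rewrite {1}[a]codeP; exact: (gE (Star _)).
  + by move=> s a; rewrite {1}[a]codeP; exact: (gE (Scale _ _)).
- by move=> x; exact: (gE (Var _ x)).
move=> g [[gh gs] gj]; apply/funext => a; rewrite [in RHS](codeP a).
rewrite (teval_hom _ _ gh gs).
by congr teval; apply/funext => x; rewrite /= gj.
Qed.

End Generation.

(** * Lattice-ordered groups of functions *)

Section FunLGroup.
Variables (R : realType) (Y : Type).
Implicit Types f g : Y -> R.

(** Differences and maxima yield the other operations; boundedness makes the constant 1 a strong
    unit. *)
Record fun_lgroup_set := FunLGroupSet {
  flg_set :> set (Y -> R);
  flg_sub : forall f g, flg_set f -> flg_set g -> flg_set (fun y => f y - g y);
  flg_max : forall f g, flg_set f -> flg_set g -> flg_set (fun y => Num.max (f y) (g y));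
  flg_one : flg_set (fun=> 1);
  flg_bounded : forall f, flg_set f -> exists n : nat, forall y, f y <= n%:R
}.

Variable Q : fun_lgroup_set.

Definition flgroup : Type := set_type Q.
HB.instance Definition _ := SubChoice.on flgroup.
Implicit Types a b c : flgroup.

Definition flg_mk f (hf : flg_set Q f) : flgroup := exist _ f (mem_set hf).
Lemma flg_valP a : flg_set Q (\val a). Proof. exact: set_mem (valP a). Qed.
Lemma flg_eqP a b : (forall y, \val a y = \val b y) -> a = b.
Proof. by move=> h; apply: val_inj; apply/funext. Qed.

Lemma flg_zero : flg_set Q (fun=> 0).
Proof.
have -> : (fun=> 0) = (fun=> 1 - 1) :> (Y -> R) by apply/funext => y; rewrite subrr.
exact: flg_sub (flg_one Q) (flg_one Q).
Qed.
Lemma flg_opp f : flg_set Q f -> flg_set Q (fun y => - f y).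
Proof.
move=> hf; have := flg_sub flg_zero hf.
by congr (flg_set Q _); apply/funext => y; rewrite sub0r.
Qed.
Lemma flg_add f g : flg_set Q f -> flg_set Q g -> flg_set Q (fun y => f y + g y).
Proof.
move=> hf /flg_opp hg; have := flg_sub hf hg.
by congr (flg_set Q _); apply/funext => y; rewrite opprK.
Qed.
Lemma flg_min f g : flg_set Q f -> flg_set Q g ->
  flg_set Q (fun y => Num.min (f y) (g y)).
Proof.
move=> hf hg; have := flg_opp (flg_max (flg_opp hf) (flg_opp hg)).
by congr (flg_set Q _); apply/funext => y; rewrite oppr_max !opprK.
Qed.
Lemma flg_Mn f n : flg_set Q f -> flg_set Q (fun y => f y *+ n).
Proof.
move=> hf; elim: n => [|n IH]; first exact: flg_zero.
have := flg_add hf IH.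
by congr (flg_set Q _); apply/funext => y; rewrite mulrS.
Qed.

Definition flgroup_zero := flg_mk flg_zero.
Definition flgroup_add a b := flg_mk (flg_add (flg_valP a) (flg_valP b)).
Definition flgroup_opp a := flg_mk (flg_opp (flg_valP a)).
Definition flgroup_meet a b := flg_mk (flg_min (flg_valP a) (flg_valP b)).
Definition flgroup_join a b := flg_mk (flg_max (flg_valP a) (flg_valP b)).
Definition flgroup_le a b : bool := `[< forall y, \val a y <= \val b y >].

Lemma flgroup_addA : associative flgroup_add.
Proof. by move=> a b c; apply: flg_eqP => y /=; rewrite addrA. Qed.
Lemma flgroup_addC : commutative flgroup_add.
Proof. by move=> a b; apply: flg_eqP => y /=; rewrite addrC. Qed.
Lemma flgroup_add0 : left_id flgroup_zero flgroup_add.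
Proof. by move=> a; apply: flg_eqP => y /=; rewrite add0r. Qed.
Lemma flgroup_addN : left_inverse flgroup_zero flgroup_opp flgroup_add.
Proof. by move=> a; apply: flg_eqP => y /=; rewrite addNr. Qed.
HB.instance Definition _ := GRing.isZmodule.Build flgroup
  flgroup_addA flgroup_addC flgroup_add0 flgroup_addN.

Lemma flgroup_le_refl : reflexive flgroup_le.
Proof. by move=> a; apply/asboolP => y; exact: lexx. Qed.
Lemma flgroup_le_anti : antisymmetric flgroup_le.
Proof.
move=> a b /andP[/asboolP h1 /asboolP h2]; apply: flg_eqP => y.
by apply/eqP; rewrite eq_le h1 h2.
Qed.
Lemma flgroup_le_trans : transitive flgroup_le.
Proof.
move=> b a c /asboolP h1 /asboolP h2; apply/asboolP => y.
exact: le_trans (h1 y) (h2 y).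
Qed.
HB.instance Definition _ := Order.Le_isPOrder.Build ring_display flgroup
  flgroup_le_refl flgroup_le_anti flgroup_le_trans.

Lemma flgroup_leP a b : reflect (forall y, \val a y <= \val b y) (a <= b).
Proof. exact: asboolP. Qed.

Lemma flgroup_le_meet a b c : (a <= flgroup_meet b c) = (a <= b) && (a <= c).
Proof.
apply/flgroup_leP/andP => [h|[/flgroup_leP h1 /flgroup_leP h2] y].
  by split; apply/flgroup_leP => y; have := h y; rewrite le_min => /andP[].
by rewrite le_min h1 h2.
Qed.
Lemma flgroup_join_le a b c : (flgroup_join a b <= c) = (a <= c) && (b <= c).
Proof.
apply/flgroup_leP/andP => [h|[/flgroup_leP h1 /flgroup_leP h2] y].
  by split; apply/flgroup_leP => y; have := h y; rewrite ge_max => /andP[].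
by rewrite ge_max h1 h2.
Qed.
Lemma flgroup_leD2l a b c : a <= b -> c + a <= c + b.
Proof. by move=> /flgroup_leP h; apply/flgroup_leP => y; rewrite lerD2l; exact: h. Qed.
HB.instance Definition _ := isLGroup.Build flgroup
  flgroup_le_meet flgroup_join_le flgroup_leD2l.

Lemma flgroup_DE a b y : \val (a + b) y = \val a y + \val b y.
Proof. by []. Qed.
Lemma flgroup_MnE a n y : \val (a *+ n) y = \val a y *+ n.
Proof. by elim: n => [|n IH] //; rewrite !mulrS flgroup_DE IH. Qed.

Definition flgroup_one : flgroup := flg_mk (flg_one Q).

Lemma flgroup_one_ge0 : 0 <= flgroup_one.
Proof. by apply/flgroup_leP => y; exact: ler01. Qed.
Lemma flgroup_one_strong a : exists n : nat, a <= flgroup_one *+ n.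
Proof.
have [n hn] := flg_bounded (flg_valP a); exists n; apply/flgroup_leP => y.
by rewrite flgroup_MnE; exact: hn.
Qed.

Definition flgroup_unit : strongUnit flgroup :=
  StrongUnit flgroup_one_ge0 flgroup_one_strong.

Lemma gamma_fun_subproof (a : gamma flgroup_unit) y : 0 <= \val (\val a) y <= 1.
Proof.
apply/andP; split; last by have /flgroup_leP/(_ y) := gamma_le a.
by have /flgroup_leP/(_ y) := gamma_ge0 a.
Qed.
Definition gamma_fun (a : gamma flgroup_unit) : fun01 R Y :=
  fun01_mk (gamma_fun_subproof a).

Lemma gamma_funE (a : gamma flgroup_unit) y : \val (gamma_fun a) y = \val (\val a) y.
Proof. by []. Qed.

Lemma gamma_fun_hom : mv_hom gamma_fun.
Proof.
by split=> [|a b|a]; apply: fun01_eqP => y //=; rewrite minC.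
Qed.

Lemma gamma_fun_inj : injective gamma_fun.
Proof.
move=> a b e; apply: val_inj; apply: flg_eqP => y.
by rewrite -!gamma_funE e.
Qed.

Lemma gamma_fun_surj (f : fun01 R Y) : flg_set Q (\val f) ->
  exists c : gamma flgroup_unit, gamma_fun c = f.
Proof.
move=> hf; have h : 0 <= flg_mk hf <= su_val flgroup_unit.
  by apply/andP; split; apply/flgroup_leP => y; [exact: fun01_ge0 | exact: fun01_le1].
by exists (Gamma h); exact: fun01_eqP.
Qed.

End FunLGroup.

(** * Truncation to the unit interval and integer slices *)

Section Clip.
Variable R : realType.
Implicit Types x y : R.

Definition clip x : R := Num.max 0 (Num.min 1 x).

Lemma clip01P x : 0 <= clip x <= 1.
Proof. by rewrite /clip; minmax_lra. Qed.
Lemma clip_id x : 0 <= x <= 1 -> clip x = x.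
Proof. by rewrite /clip => /andP[]; minmax_lra. Qed.
Lemma clip_ge1 x : 1 <= x -> clip x = 1.
Proof. by rewrite /clip; minmax_lra. Qed.
Lemma clip_le0 x : x <= 0 -> clip x = 0.
Proof. by rewrite /clip; minmax_lra. Qed.
Lemma clipN x : clip (- x) = 1 - clip (x + 1).
Proof. by rewrite /clip; minmax_lra. Qed.
Lemma clip_max x y : clip (Num.max x y) = Num.max (clip x) (clip y).
Proof.
have mono u v : u <= v -> clip u <= clip v by rewrite /clip; minmax_lra.
by case: (leP x y) => [|/ltW] /mono; [move/max_idPr|move/max_idPl].
Qed.
(** In MV terms: slice [k] of [g + a] is [odot] of slice [k - 1] of [g] with [a], plus slice [k] of
    [g]. This keeps slices of sums inside the algebra. *)
Lemma clipD x a : 0 <= a <= 1 ->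
  clip (x + a) = Num.min 1 (Num.max 0 (clip (x + 1) + a - 1) + clip x).
Proof.
case/andP=> a0 a1; have [x0|/ltW x0] := lerP 0 x.
  rewrite (@clip_ge1 (x + 1)) ?ler_wpDl // (_ : 1 + a - 1 = a); last by ring.
  rewrite (max_idPr a0); have [x1|/ltW x1] := lerP 1 x.
    rewrite !clip_ge1 //; last by lra.
    by apply/esym/min_idPl; lra.
  rewrite (@clip_id x) ?x0 // addrC; apply/max_idPr.
  by rewrite le_min ler01 addr_ge0.
rewrite (clip_le0 x0) addr0; have [x1|/ltW x1] := lerP x (-1).
  rewrite !clip_le0; [|lra..].
  by rewrite (max_idPl _) ?(min_idPr _) //; lra.
rewrite (@clip_id (x + 1)); last by apply/andP; split; lra.
rewrite addrAC addrK /clip (min_idPr _); last by lra.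
by rewrite (min_idPr _) // ge_max ler01 /=; lra.
Qed.
Lemma clip_nneg x : 0 <= x -> x = clip x + Num.max (x - 1) 0.
Proof. by rewrite /clip; minmax_lra. Qed.

Variable Y : Type.
Definition clipf (f : Y -> R) : fun01 R Y := fun01_mk (fun z => clip01P (f z)).

End Clip.

(* For an MV-algebra [A] of [0,1]-valued functions, the bounded functions all of
   whose integer slices [(f - k) \/ 0 /\ 1] lie in [A] form the l-group [G] with
   [Gamma(G, 1) = A]. *)
Section SliceGroup.
Variables (R : realType) (Y : Type) (A : mvSub (fun01 R Y)).
Implicit Types f g : Y -> R.

Definition slice_set : set (Y -> R) :=
  [set f | (exists n : nat, forall y, `|f y| <= n%:R) /\
    forall k : int, mvsub_set A (clipf (fun y => f y - k%:~R))].

Lemma mvsub_one : mvsub_set A (mv_one _).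
Proof. exact: mvsub_star (mvsub0 A). Qed.

Lemma mvsub_odot a b : mvsub_set A a -> mvsub_set A b -> mvsub_set A (odot a b).
Proof. by move=> ha hb; apply/mvsub_star/mvsubD; exact: mvsub_star. Qed.

Lemma slice_fun01 a : mvsub_set A a -> slice_set (\val a).
Proof.
move=> Aa; split.
  by exists 1%N => y; rewrite ger0_norm ?fun01_ge0 ?fun01_le1.
move=> k; have [k0|k0|->] := ltrgt0P k.
- rewrite (_ : clipf _ = 0); first exact: mvsub0.
  apply: fun01_eqP => y; apply: clip_le0.
  have := fun01_le1 a y; have : 1 <= k%:~R :> R by rewrite ler1z; lia.
  lra.
- rewrite (_ : clipf _ = mv_one _); first exact: mvsub_one.
  apply: fun01_eqP => y; rewrite fun01_1E; apply: clip_ge1.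
  have := fun01_ge0 a y; have : k%:~R <= -1 :> R.
    by rewrite -[-1]/(- 1%:~R) -[- 1%:~R]/((-1)%:~R) ler_int; lia.
  lra.
- rewrite (_ : clipf _ = a) //; apply: fun01_eqP => y.
  by rewrite /= subr0; exact: clip_id (fun01P a y).
Qed.

Lemma slice_clip f : slice_set f -> mvsub_set A (clipf f).
Proof.
by case=> _ /(_ 0); congr (mvsub_set A (clipf _)); apply/funext => y; rewrite subr0.
Qed.

Lemma slice_shift f (m : int) : slice_set f -> slice_set (fun y => f y + m%:~R).
Proof.
case=> [[n hn] hf]; split.
  exists (n + `|m|)%N => y; rewrite (le_trans (ler_normD _ _)) // natrD lerD //.
  by rewrite natr_absz intr_norm.
move=> k; have := hf (k - m); congr (mvsub_set A (clipf _)); apply/funext => y.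
by rewrite intrB; ring.
Qed.

(** Slice [k] of [- f] is the complement of slice [- k - 1] of [f]. *)
Lemma slice_opp f : slice_set f -> slice_set (fun y => - f y).
Proof.
case=> [[n hn] hf]; split; first by exists n => y; rewrite normrN.
move=> k; have := mvsub_star (hf (- k - 1)).
congr (mvsub_set A _); apply: fun01_eqP => y; rewrite fun01_starE /=.
have -> : - f y - k%:~R = - (f y + k%:~R) by ring.
by rewrite clipN; congr (1 - clip _); rewrite rmorphB rmorphN /=; ring.
Qed.

Lemma slice_max f g : slice_set f -> slice_set g ->
  slice_set (fun y => Num.max (f y) (g y)).
Proof.
move=> [[n hn] hf] [[m hm] hg]; split.
  exists (n + m)%N => y; rewrite natrD.
  have := hn y; have := hm y; have : 0 <= n%:R :> R by []; have : 0 <= m%:R :> R by [].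
  rewrite !ler_norml => h1 h2 /andP[h3 h4] /andP[h5 h6].
  by apply/andP; split; minmax_lra.
move=> k; have := mvsubD (mvsub_odot (hf k) (mvsub_star (hg k))) (hg k).
congr (mvsub_set A _); apply: fun01_eqP => y.
rewrite fun01_DE -/(mv_sub _ _) fun01_subE /= [in RHS]addr_maxl clip_max.
have := clip01P (f y - k%:~R); have := clip01P (g y - k%:~R).
by move: (clip _) (clip _) => u v /andP[? ?] /andP[? ?]; minmax_lra.
Qed.

Lemma slice_add_fun01 g a : slice_set g -> mvsub_set A a ->
  slice_set (fun y => g y + \val a y).
Proof.
move=> [[n hn] hg] Aa; split.
  exists (n + 1)%N => y; rewrite (le_trans (ler_normD _ _)) // natrD lerD //.
  by rewrite ger0_norm ?fun01_ge0 ?fun01_le1.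
move=> k; have := mvsubD (mvsub_odot (hg (k - 1)) Aa) (hg k).
congr (mvsub_set A _); apply: fun01_eqP => y; rewrite fun01_DE fun01_odotE.
have e1 : g y + \val a y - k%:~R = (g y - k%:~R) + \val a y by ring.
have e2 : g y - (k - 1)%:~R = (g y - k%:~R) + 1 by rewrite intrB; ring.
by rewrite /= [in RHS]e1 clipD ?fun01P // e2.
Qed.

(** An integer shift makes [g] nonnegative. By induction on an integer upper bound its bottom slice
    [clipf h] is peeled off and added as an element of [A], leaving [max (h - 1) 0]. *)
Lemma slice_add f g : slice_set f -> slice_set g -> slice_set (fun y => f y + g y).
Proof.
suff pos (m : nat) h : slice_set h -> (forall y, 0 <= h y <= m%:R) ->
    forall e, slice_set e -> slice_set (fun y => e y + h y).
  move=> hf hg; have [[n hn] _] := hg.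
  have := @pos (n + n)%N _ (slice_shift n hg) _ f hf.
  move=> /(_ _)/(slice_shift (- n%:Z)) => H.
  have := H _; rewrite (_ : (fun y => _ + _) = (fun y => f y + g y)).
    apply=> y; have := hn y; rewrite natrD ler_norml => /andP[? ?].
    by apply/andP; split; rewrite -[n%:~R]/(n%:R); lra.
  by apply/funext => y; rewrite intrN; ring.
elim: m h => [|m IH] h hh h0 e he.
  rewrite (_ : (fun y => _) = e) //; apply/funext => y.
  by have := h0 y; rewrite -eq_le => /eqP <-; rewrite addr0.
pose h' y := Num.max (h y - 1) 0.
have hh' : slice_set h'.
  apply: slice_max; first exact: (slice_shift (-1) hh).
  exact: (slice_fun01 (mvsub0 A)).
rewrite (_ : (fun y => _) = (fun y => (e y + \val (clipf h) y) + h' y)).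
  apply: IH => //; last by apply: slice_add_fun01 => //; exact: slice_clip.
  move=> y; have := h0 y; rewrite /h' -natr1 => /andP[? ?].
  have : 0 <= m%:R :> R by [].
  minmax_lra.
apply/funext => y; have /andP[+ _] := h0 y; move=> /clip_nneg {1}->.
by rewrite addrA.
Qed.

Lemma slice_sub f g : slice_set f -> slice_set g -> slice_set (fun y => f y - g y).
Proof. by move=> hf /slice_opp; exact: slice_add. Qed.

Lemma slice_one : slice_set (fun=> 1).
Proof.
have := slice_fun01 mvsub_one; congr slice_set.
by apply/funext => y; rewrite fun01_1E.
Qed.

Lemma slice_bounded f : slice_set f -> exists n : nat, forall y, f y <= n%:R.
Proof.
by case=> [[n hn] _]; exists n => y; exact: le_trans (ler_norm _) (hn y).
Qed.

Definition slice_group : fun_lgroup_set R Y :=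
  FunLGroupSet slice_sub slice_max slice_one slice_bounded.

Definition div_set : set (Y -> R) :=
  [set f | exists2 n : nat, (0 < n)%N & slice_set (fun y => f y *+ n)].

Lemma div_common f g : div_set f -> div_set g ->
  exists2 n : nat, (0 < n)%N & slice_set (fun y => f y *+ n) /\ slice_set (fun y => g y *+ n).
Proof.
move=> [n n0 hf] [m m0 hg]; exists (n * m)%N; first by rewrite muln_gt0 n0.
split.
  have := @flg_Mn _ _ slice_group _ m hf.
  by congr slice_set; apply/funext => y; rewrite mulrnA.
have := @flg_Mn _ _ slice_group _ n hg.
by congr slice_set; apply/funext => y; rewrite mulnC mulrnA.
Qed.

Lemma div_sub f g : div_set f -> div_set g -> div_set (fun y => f y - g y).
Proof.
move=> hf hg; have [n n0 [h1 h2]] := div_common hf hg; exists n => //.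
have := slice_sub h1 h2; congr slice_set; apply/funext => y.
by rewrite mulrnBl.
Qed.
Lemma div_max f g : div_set f -> div_set g -> div_set (fun y => Num.max (f y) (g y)).
Proof.
move=> hf hg; have [n n0 [h1 h2]] := div_common hf hg; exists n => //.
have := slice_max h1 h2; congr slice_set; apply/funext => y.
by rewrite -[RHS]mulr_natl maxr_pMr ?ler0n // !mulr_natl.
Qed.
Lemma slice_div f : slice_set f -> div_set f.
Proof. by exists 1%N. Qed.
Lemma div_bounded f : div_set f -> exists n : nat, forall y, f y <= n%:R.
Proof.
case=> n n0 /slice_bounded[m hm]; exists m => y.
have n1 : 1 <= n%:R :> R by rewrite ler1n.
have := hm y; rewrite -[f y *+ n]mulr_natl.
have [f0|/ltW f0] := lerP 0 (f y); first by move=> h; apply: le_trans _ h; rewrite ler_peMl.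
by move=> _; apply: le_trans f0 _.
Qed.

Definition div_group : fun_lgroup_set R Y :=
  FunLGroupSet div_sub div_max (slice_div slice_one) div_bounded.

Definition slice_incl (g : flgroup slice_group) : flgroup div_group :=
  @flg_mk _ _ div_group (\val g) (slice_div (flg_valP g)).

Lemma divMnK (x : R) n : (0 < n)%N -> x / n%:R *+ n = x.
Proof. by move=> n0; rewrite -[LHS]mulr_natr divfK // pnatr_eq0 -lt0n. Qed.

Lemma slice_divisible_hull : divisible_hull slice_incl.
Proof.
split.
- split=> [a b e|a b|a b|a b]; apply: flg_eqP => y //.
  by have := congr1 (fun u => \val u y) e.
- move=> g n n0.
  have h : div_set (fun y => \val g y / n%:R).
    exists n => //; rewrite (_ : (fun y => _) = \val g); first exact: (flg_valP g).
    by apply/funext => y; rewrite divMnK.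
  exists (@flg_mk _ _ div_group _ h); apply: flg_eqP => y.
  by rewrite flgroup_MnE /= divMnK.
- move=> d; have [n n0 h] := flg_valP d.
  exists (@flg_mk _ _ slice_group _ h), n; split=> //.
  by apply: flg_eqP => y; rewrite flgroup_MnE.
Qed.

Lemma gamma_slice_mem (a : gamma (flgroup_unit slice_group)) :
  mvsub_set A (gamma_fun a).
Proof.
have := slice_clip (flg_valP (\val a)).
by congr (mvsub_set A _); apply: fun01_eqP => y; exact: (clip_id (fun01P (gamma_fun a) y)).
Qed.

End SliceGroup.

(** * Dedekind-MacNeille completion of an algebra of continuous functions *)

Lemma mvsub_val_hom (A : mvType) (S : mvSub A) :
  mv_hom (\val : mvsub_sort S -> A).
Proof. by []. Qed.

Lemma mvsub_leE (A : mvType) (S : mvSub A) (a b : mvsub_sort S) :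
  mv_le a b <-> mv_le (\val a) (\val b).
Proof.
split; first exact: (mv_hom_le (@mvsub_val_hom A S)).
exact: (mv_hom_le_inj (@mvsub_val_hom A S) val_inj).
Qed.

Lemma mv_complete_sup (A : mvType) :
  (forall S : set A, exists a, mv_is_sup S a) -> mv_complete A.
Proof.
move=> h S; split=> //.
have [a [ub lub]] := h [set star s | s in S]; exists (star a); split.
  by move=> s Ss; rewrite -[s]starK; apply: mv_le_star; apply: ub; exists s.
move=> b hb; rewrite -[b]starK; apply: mv_le_star; apply: lub => _ [s Ss <-].
by apply: mv_le_star; exact: hb.
Qed.

(* The algebra [N] of functions that are nearly constant on a dense family of
   opens, modulo the ideal [I] of those that are small on such a family, is
   complete: lower semicontinuous functions lie in [N], and a supremum in [N/I]
   is the supremum of the lower envelopes. *)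
Section Completion.
Variables (R : realType) (Y : Type) (op : set (set Y)).
Hypothesis opT : op setT.
Hypothesis opI : forall O O', op O -> op O' -> op (O `&` O').
Implicit Types (f g : Y -> R) (O : set Y) (e : R).

Definition dense_op (P : set Y -> Prop) : Prop :=
  forall O, op O -> O !=set0 -> exists O', [/\ op O', O' !=set0, O' `<=` O & P O'].

(** The dense family may vary with [e], which avoids any Baire category argument. *)
Definition near_const f : Prop :=
  forall e, 0 < e -> dense_op (fun O => forall y z, O y -> O z -> f y - f z <= e).

Definition small f : Prop :=
  forall e, 0 < e -> dense_op (fun O => forall y, O y -> f y <= e).

Definition op_cont f : Prop :=
  forall p e, 0 < e -> exists O, [/\ op O, O p & forall q, O q -> `|f q - f p| <= e].

Lemma op_cont_near_const f : op_cont f -> near_const f.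
Proof.
move=> hf e e0 O oO [p Op]; have e2 : 0 < e / 2 by lra.
have [O' [oO' O'p h]] := hf p _ e2.
exists (O `&` O'); split; [exact: opI|by exists p|exact: subIsetl|].
move=> y z [_ /h hy] [_ /h hz].
by move: hy hz; rewrite !ler_norml => /andP[? ?] /andP[? ?]; lra.
Qed.

(** Continuity spreads a positive value over a whole open, where smallness contradicts it. Hence
    distinct continuous functions stay distinct in the quotient. *)
Lemma op_cont_small f : op_cont f -> small f -> forall p, f p <= 0.
Proof.
move=> hf sf p; rewrite leNgt; apply/negP => fp.
have e0 : 0 < f p / 4 by lra.
have [O [oO Op h]] := hf p _ e0.
have [O' [_ [q O'q] sO' h']] := sf _ e0 O oO (ex_intro _ p Op).
by have := h' q O'q; have := h q (sO' q O'q); rewrite ler_norml => /andP[? ?]; lra.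
Qed.

Lemma op_contD f g : op_cont f -> op_cont g -> op_cont (fun y => f y + g y).
Proof.
move=> hf hg p e e0; have e2 : 0 < e / 2 by lra.
have [O [oO Op h]] := hf p _ e2; have [O' [oO' O'p h']] := hg p _ e2.
exists (O `&` O'); split; [exact: opI|by []|].
move=> q [/h + /h']; rewrite !ler_norml => /andP[? ?] /andP[? ?].
by apply/andP; split; lra.
Qed.

Lemma op_cont_lip f (c : R -> R) : op_cont f ->
  (forall u v, `|c u - c v| <= `|u - v|) -> op_cont (fun y => c (f y)).
Proof.
move=> hf hc p e e0; have [O [oO Op h]] := hf p e e0.
exists O; split=> // q Oq; exact: le_trans (hc _ _) (h q Oq).
Qed.

Lemma op_cont_cst (c : R) : op_cont (fun=> c).
Proof. by move=> p e e0; exists setT; split=> // q _; rewrite subrr normr0 ltW. Qed.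

Definition nc_set : set (fun01 R Y) := [set a | near_const (\val a)].

Lemma nc0 : nc_set 0.
Proof.
move=> e e0 O oO O0; exists O; split=> // y z _ _; rewrite !fun01_0E; lra.
Qed.
Lemma ncD a b : nc_set a -> nc_set b -> nc_set (a + b).
Proof.
move=> ha hb e e0 O oO O0; have e2 : 0 < e / 2 by lra.
have [O1 [oO1 O10 s1 h1]] := ha _ e2 O oO O0.
have [O2 [oO2 O20 s2 h2]] := hb _ e2 O1 oO1 O10.
exists O2; split=> //; first exact: subset_trans s2 s1.
move=> y z O2y O2z; rewrite !fun01_DE.
have := h1 y z (s2 y O2y) (s2 z O2z); have := h2 y z O2y O2z.
minmax_lra.
Qed.
Lemma nc_star a : nc_set a -> nc_set (star a).
Proof.
move=> ha e e0 O oO O0; have [O1 [oO1 O10 s1 h1]] := ha _ e0 O oO O0.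
exists O1; split=> // y z O1y O1z; rewrite !fun01_starE.
have := h1 z y O1z O1y; lra.
Qed.
Lemma nc_scal (r : {i01 R}) a : nc_set a -> nc_set (scal r a).
Proof.
move=> ha e e0 O oO O0; have [O1 [oO1 O10 s1 h1]] := ha _ e0 O oO O0.
exists O1; split=> // y z O1y O1z; rewrite !fun01_scalE -mulrBr.
apply: le_trans (_ : r%:num * e <= _); first by rewrite ler_wpM2l ?h1.
by apply: ler_piMl; [exact: ltW|exact: le1].
Qed.

Definition nc_alg : rieszSub (fun01 R Y) :=
  RieszSub (rsub_mv := MVSub nc0 ncD nc_star) nc_scal.

Local Notation N := (rsub_sort nc_alg).

Definition nc_mk (a : fun01 R Y) (ha : near_const (\val a)) : N :=
  @mvsub_mk _ nc_alg a ha.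

Lemma nc_near (a : N) : near_const (\val (\val a)).
Proof. exact: (mvsub_valP a). Qed.

Definition nc_null : set N := [set a | small (\val (\val a))].

Lemma nc_leP (a b : N) : mv_le a b <-> forall y, \val (\val a) y <= \val (\val b) y.
Proof. by rewrite -fun01_leP; exact: (@mvsub_leE _ nc_alg). Qed.

Lemma nc_null_ideal : mv_ideal nc_null.
Proof.
split.
- by exists 0 => e e0 O oO O0; exists O; split=> // y _; rewrite fun01_0E ltW.
- move=> a b /nc_leP ab hb e e0 O oO O0.
  have [O1 [oO1 O10 s1 h1]] := hb _ e0 O oO O0.
  by exists O1; split=> // y /h1; exact: le_trans.
- move=> a b ha hb e e0 O oO O0; have e2 : 0 < e / 2 by lra.
  have [O1 [oO1 O10 s1 h1]] := ha _ e2 O oO O0.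
  have [O2 [oO2 O20 s2 h2]] := hb _ e2 O1 oO1 O10.
  exists O2; split=> //; first exact: subset_trans s2 s1.
  move=> y O2y; have := h1 y (s2 y O2y); have := h2 y O2y.
  by rewrite [\val (\val (a + b)) y]fun01_DE; minmax_lra.
Qed.

Definition completion : rieszMVType R := rquot nc_null_ideal.

Local Notation pi := (rpi nc_null_ideal).

Lemma completion_le (a b : N) : mv_le (pi a) (pi b) <->
  small (fun y => \val (\val a) y - \val (\val b) y).
Proof.
rewrite (@mvpi_le _ _ nc_null_ideal); split=> h e e0 O oO O0;
  have [O1 [oO1 O10 s1 h1]] := h e e0 O oO O0; exists O1; split=> // y /h1;
  rewrite [\val (\val (mv_sub a b)) y]fun01_subE; minmax_lra.
Qed.

Lemma pi_reprK (c : completion) : exists a : N, c = pi a.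
Proof. by exists (mvrepr c); rewrite /rpi mvreprK. Qed.

Section Sup.
Variable T : set N.

(** Constants lying below some member of [T] on a whole neighbourhood of [y]; their supremum is
    lower semicontinuous by construction. The value 0 keeps the set nonempty when [T] is empty. *)
Definition env_set (y : Y) : set R :=
  [set r | r = 0 \/ exists a O, [/\ T a, op O, O y &
    r <= 1 /\ forall z, O z -> r <= \val (\val a) z]].

Definition env (y : Y) : R := sup (env_set y).

Lemma env_has_sup y : has_sup (env_set y).
Proof. by split; [exists 0; left | exists 1 => r [->|[a [O [_ _ _ []]]]]]. Qed.

Lemma env_ub y r : env_set y r -> r <= env y.
Proof. by move=> h; apply: sup_upper_bound => //; exact: env_has_sup. Qed.

Lemma env_subproof y : 0 <= env y <= 1.
Proof.
apply/andP; split; first by apply: env_ub; left.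
apply: ge_sup; first by exists 0; left.
by move=> r [->|[a [O [_ _ _ []]]]].
Qed.

Lemma env_lsc y e : 0 < e ->
  exists O, [/\ op O, O y & forall z, O z -> env y - e <= env z].
Proof.
move=> e0; have [r hr /ltW ry] := sup_adherent e0 (env_has_sup y).
case: hr => [r0|[a [O [Ta oO Oy [r1 h]]]]].
  exists setT; split=> // z _; apply: le_trans ry _; rewrite r0.
  by case/andP: (env_subproof z).
exists O; split=> // z Oz; apply: le_trans ry _; apply: env_ub; right.
by exists a, O.
Qed.

(** Near a point where [env] almost reaches its supremum over [O], semicontinuity bounds it from
    below and that supremum bounds it from above. *)
Lemma env_near_const : near_const env.
Proof.
move=> e e0 O oO [p Op]; have e2 : 0 < e / 2 by lra.
have hs : has_sup (env @` O).
  split; first by exists (env p), p.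
  by exists 1 => _ [z _ <-]; case/andP: (env_subproof z).
have [_ [y Oy <-] /ltW hy] := sup_adherent e2 hs.
have [O' [oO' O'y h']] := env_lsc y e2.
exists (O `&` O'); split; [exact: opI|by exists y|exact: subIsetl|].
move=> z w [Oz _] [_ /h' hw].
have : env z <= sup (env @` O) by apply: sup_upper_bound => //; exists z.
lra.
Qed.

Definition envN : N := @nc_mk (fun01_mk env_subproof) env_near_const.

Lemma env_is_sup : mv_is_sup [set pi a | a in T] (pi envN).
Proof.
split.
  (* Where [a] oscillates by at most [e], the constant [a y - e] lies below [a], so it takes part in
     the envelope at [y]. *)
  move=> _ [a Ta <-]; apply/completion_le => e e0 O oO O0.
  have [O1 [oO1 O10 s1 h1]] := nc_near a e0 oO O0.
  exists O1; split=> // y O1y; rewrite lerBlDr -lerBlDl.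
  apply: env_ub; right; exists a, O1; split=> //; split=> [|z O1z].
    by have := fun01_le1 (\val a) y; lra.
  by rewrite lerBlDl -lerBlDr; exact: h1.
move=> b; have [h -> hub] := pi_reprK b.
(* Four errors add up: the oscillations of [h] and of [env], the gap between [env y] and [r], and
   the amount by which [a] may exceed [h]. *)
apply/completion_le => e e0 O oO O0; have e4 : 0 < e / 4 by lra.
have [O1 [oO1 O10 s1 h1]] := nc_near h e4 oO O0.
have [O2 [oO2 [y O2y] s2 h2]] := env_near_const e4 oO1 O10.
exists O2; split=> //; [by exists y|exact: subset_trans s2 s1|].
move=> w O2w; rewrite [\val (\val envN) w]/=.
have hw := h2 w y O2w O2y.
have [r hr ry] := sup_adherent e4 (env_has_sup y); rewrite -/(env y) in ry.
case: hr => [r0|[a [O3 [Ta oO3 O3y [r1 h3]]]]].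
  by have := fun01_ge0 (\val h) w; lra.
have /completion_le sm : mv_le (pi a) (pi h) by apply: hub; exists a.
have [O4 [_ [z O4z] s4 h4]] := sm _ e4 _ (opI oO2 oO3) (ex_intro _ y (conj O2y O3y)).
have [O2z O3z] := s4 z O4z.
have := h4 z O4z; have := h3 z O3z; have := h1 z w (s2 z O2z) (s2 w O2w); lra.
Qed.
End Sup.

Lemma completion_complete : mv_complete completion.
Proof.
apply: mv_complete_sup => S; pose T : set N := [set a | S (pi a)].
exists (pi (envN T)); have := env_is_sup T.
rewrite (_ : [set pi a | a in T] = S) //; apply/seteqP; split=> [_ [a Ta <-] //|c Sc].
by have [a ca] := pi_reprK c; move: Sc; rewrite ca => Sc; exists a.
Qed.

Section Dense.
Variables (D : mvType) (h : D -> fun01 R Y).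
Hypothesis h_emb : mv_embedding h.
Hypothesis h_cont : forall d, op_cont (\val (h d)).
Hypothesis h_bump : forall O (alpha delta : R), op O -> O !=set0 ->
  0 < alpha <= 1 -> 0 < delta ->
  exists d : D, [/\ forall y, \val (h d) y <= alpha, forall y, ~ O y -> \val (h d) y = 0
    & exists2 p, O p & alpha - delta <= \val (h d) p].

Definition to_completion (d : D) : completion :=
  pi (nc_mk (op_cont_near_const (h_cont d))).

Lemma to_completion_hom : mv_hom to_completion.
Proof.
have [hh _] := h_emb.
have [[p0 pD ps] _] := rpi_hom nc_null_ideal.
have mkE (a : N) d : \val a = h d -> pi a = to_completion d.
  by move=> e; congr (pi _); exact: val_inj.
split=> [|a b|a].
- by rewrite -(mkE 0) // mv_hom0.
- pose m d := nc_mk (op_cont_near_const (h_cont d)).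
  by rewrite -(mkE (m a + m b)) ?(mv_homD hh) //; exact: pD.
- pose m d := nc_mk (op_cont_near_const (h_cont d)).
  by rewrite -(mkE (star (m a))) ?(mv_hom_star hh) //; exact: ps.
Qed.

(** For density, suppose [g] bounds all elements below [f] but not [f] itself. Then [f] exceeds [g]
    by a fixed amount on an open where both are nearly constant, and a bump supported there fits
    below [f] without being below [g]. *)
Lemma to_completion_dm : dedekind_macneille to_completion.
Proof.
have [hh hinj] := h_emb.
split; last 1 first.
- move=> c; exists [set d | mv_le (to_completion d) c]; split.
    by move=> _ [d hd <-].
  have [f ->] := pi_reprK c; move=> b; have [g -> hub] := pi_reprK b.
  apply/completion_le => e e0 O oO O0; apply: contrapT => nO.
  (* The bump has height at most [f y - e / 8] to absorb the oscillation of [f]; the remaining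
     errors total [5 e / 8], still less than the gap [e]. *)
  have e8 : 0 < e / 8 by lra.
  have [O1 [oO1 O10 s1 h1]] := nc_near f e8 oO O0.
  have [O2 [oO2 O20 s2 h2]] := nc_near g e8 oO1 O10.
  have [y O2y ye] : exists2 y, O2 y & e < \val (\val f) y - \val (\val g) y.
    apply: contrapT => ny; apply: nO; exists O2; split=> //.
      exact: subset_trans s2 s1.
    by move=> y O2y; rewrite leNgt; apply/negP => h3; apply: ny; exists y.
  have fy1 := fun01_le1 (\val f) y; have gy0 := fun01_ge0 (\val g) y.
  have al : 0 < \val (\val f) y - e / 8 <= 1 by apply/andP; split; lra.
  have [d [dle dsup [p O2p dp]]] := h_bump oO2 O20 al e8.
  have /completion_le sm : mv_le (to_completion d) (pi g).
    apply: hub; exists d => //=; apply/completion_le.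
    move=> e' e'0 O' oO' O'0; exists O'; split=> // z _.
    rewrite -[\val (\val (nc_mk _))]/(\val (h d)).
    have [O2z|nO2z] := pselect (O2 z).
      have := h1 y z (s2 y O2y) (s2 z O2z); have := dle z. lra.
    rewrite (dsup z nO2z) sub0r; apply: le_trans (ltW e'0).
    by rewrite oppr_le0 fun01_ge0.
  have [O3 [oO3 O3p h3]] := h_cont d p e8.
  have [O4 [_ [z O4z] s4 h4]] := sm _ e8 _ (opI oO2 oO3) (ex_intro _ p (conj O2p O3p)).
  have [O2z O3z] := s4 z O4z.
  have := h3 z O3z; rewrite ler_norml => /andP[h5 h6].
  have := h4 z O4z; rewrite -[\val (\val (nc_mk _))]/(\val (h d)).
  have := h2 z y O2z O2y; lra.
- split; first exact: to_completion_hom.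
  apply: (mv_hom_inj to_completion_hom) => d hd.
  have sm : small (\val (h d)).
    by have /(@mvpi_eq0 _ _ nc_null_ideal) := hd.
  apply: hinj; rewrite (mv_hom0 hh); apply: fun01_eqP => y; apply/eqP.
  by rewrite eq_le fun01_0E fun01_ge0 (op_cont_small (h_cont d) sm).
- exact: completion_complete.
Qed.

End Dense.
End Completion.

(** * Continuity and tent functions on the cube *)

Section Cube.
Variables (R : realType) (X : Type).
Local Notation Y := (X -> {i01 R}).
Implicit Types (p q : Y) (s : seq X) (d e : R) (O : set Y).

(** A basic neighbourhood of the product topology; [List.In] is used because [X] carries no
    decidable equality. *)
Definition box p s d : set Y :=
  [set q | forall x, List.In x s -> `|(q x)%:num - (p x)%:num| < d].

Definition box_open : set (set Y) :=
  [set O | forall p, O p -> exists s d, 0 < d /\ box p s d `<=` O].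

Lemma box_self p s d : 0 < d -> box p s d p.
Proof. by move=> d0 x _; rewrite subrr normr0. Qed.

Lemma box_openT : box_open setT.
Proof. by move=> p _; exists [::], 1. Qed.

Lemma box_openI O O' : box_open O -> box_open O' -> box_open (O `&` O').
Proof.
move=> hO hO' p [/hO[s [d [d0 h]]] /hO'[s' [d' [d'0 h']]]].
exists (s ++ s'), (Num.min d d'); split; first by rewrite lt_min d0.
move=> q hq; split; [apply: h|apply: h'] => x xs.
  by have := hq x (List.in_or_app _ _ _ (or_introl xs)); rewrite lt_min => /andP[].
by have := hq x (List.in_or_app _ _ _ (or_intror xs)); rewrite lt_min => /andP[].
Qed.

Lemma box_is_open p s d : 0 < d -> box_open (box p s d).
Proof.
move=> d0 q hq.
suff [d' d'0 hd'] : exists2 d', 0 < d' &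
    forall x, List.In x s -> `|(q x)%:num - (p x)%:num| + d' <= d.
  exists s, d'; split=> // r hr x xs; apply: lt_le_trans (hd' x xs).
  rewrite [X in _ < X]addrC; apply: le_lt_trans (_ : `|(r x)%:num - (q x)%:num|
    + `|(q x)%:num - (p x)%:num| < _).
    rewrite (le_trans _ (ler_normD _ _)) // le_eqVlt; apply/orP; left.
    by apply/eqP; congr `|_|; ring.
  by rewrite ltrD2r; exact: hr.
elim: s hq => [|x s IH] hq; first by exists 1.
have [|d1 d10 h1] := IH; first by move=> y ys; apply: hq; right.
have hx := hq x (or_introl erefl).
exists (Num.min d1 (d - `|(q x)%:num - (p x)%:num|)).
  by rewrite lt_min d10 subr_gt0.
move=> y [<-|/h1 hy].
  by rewrite -lerBrDl ge_min lexx orbT.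
by apply: le_trans hy; rewrite lerD2l ge_min lexx.
Qed.

Local Notation cont := (@op_cont R Y box_open).

Lemma cont_coord x : cont (fun p : Y => (p x)%:num).
Proof.
move=> p e e0; exists (box p [:: x] e); split; first exact: box_is_open.
  exact: box_self.
by move=> q hq; apply/ltW/hq; left.
Qed.

Lemma cont_min1 f : cont f -> cont (fun p => Num.min 1 (f p)).
Proof.
move=> hf; apply: (@op_cont_lip _ _ _ f (Num.min 1) hf) => u v.
rewrite ler_norml; have := ler_norm (u - v); have := ler_norm (v - u).
by rewrite [`|v - u|]distrC; move: (`|_|) => w ? ?; apply/andP; split; minmax_lra.
Qed.


Lemma cont_reval (S : Type) (kap : S -> R) (t : term S X) :
  (forall k, `|kap k| <= 1) ->
  cont (fun p : Y => reval kap (fun x => (p x)%:num) t).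
Proof.
move=> hk; elim: t => /= [x||t1 IH1 t2 IH2|t1 IH1|k t1 IH1].
- exact: cont_coord.
- exact: (op_cont_cst box_openT).
- by apply: cont_min1; apply: (op_contD box_openI).
- apply: (@op_cont_lip _ _ _ _ (fun u => 1 - u) IH1) => u v.
  by rewrite opprB addrC addrA subrK distrC.
- apply: (@op_cont_lip _ _ _ _ (fun u => kap k * u) IH1) => u v.
  by rewrite -mulrBr normrM ler_piMl.
Qed.

Lemma cont_rmvfun (t : term {i01 R} X) : cont (\val (rmvfun t)).
Proof.
rewrite (_ : \val _ = fun p => reval (fun s : {i01 R} => s%:num) (fun x => (p x)%:num) t).
  by apply: cont_reval => s; rewrite ger0_norm ?ge0 ?le1.
by apply/funext => p; rewrite rmvfunE.
Qed.

Lemma cont_mvfun (t : term void X) : cont (\val (mvfun R t)).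
Proof.
rewrite (_ : \val _ = fun p => reval (of_void R) (fun x => (p x)%:num) t).
  by apply: cont_reval => -[].
by apply/funext => p; rewrite mvfunE.
Qed.

Definition mvfun_set : set (fun01 R Y) :=
  [set a | exists t : term void X, a = mvfun R t].

Lemma mvfun_set0 : mvfun_set 0.
Proof. by exists Zero. Qed.
Lemma mvfun_setD a b : mvfun_set a -> mvfun_set b -> mvfun_set (a + b).
Proof. by move=> [t ->] [t' ->]; exists (Plus t t'). Qed.
Lemma mvfun_set_star a : mvfun_set a ->
  mvfun_set (star a).
Proof. by move=> [t ->]; exists (Star t). Qed.

Definition mvfun_sub : mvSub (fun01 R Y) := MVSub mvfun_set0 mvfun_setD mvfun_set_star.

Local Notation slice := (slice_set mvfun_sub).
Local Notation G := (slice_group mvfun_sub).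

(** The same peeling as in [slice_add]: each unit slice is a term function, hence continuous. *)
Lemma slice_cont f : slice f -> cont f.
Proof.
suff pos (m : nat) h : slice h -> (forall y, 0 <= h y <= m%:R) -> cont h.
  move=> hf; have [[n hn] _] := hf.
  have h1 : cont (fun y => f y + n%:Z%:~R).
    apply: (@pos (n + n)%N); first exact: slice_shift.
    move=> y; have := hn y; rewrite natrD ler_norml => /andP[? ?].
    by apply/andP; split; rewrite -[n%:~R]/(n%:R); lra.
  have := op_contD box_openI h1 (op_cont_cst box_openT (- n%:R)).
  by congr (op_cont _ _); apply/funext => y; rewrite -[n%:~R]/(n%:R) addrK.
elim: m h => [|m IH] h hh h0.
  rewrite (_ : h = fun=> 0); first exact: (op_cont_cst box_openT).
  by apply/funext => y; have := h0 y; rewrite -eq_le => /eqP <-.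
have ch : cont (\val (clipf h)).
  by have [t ->] := slice_clip hh; exact: cont_mvfun.
have ch' : cont (fun y => Num.max (h y - 1) 0).
  apply: IH.
    apply: slice_max; first exact: (slice_shift (-1) hh).
    exact: (slice_fun01 (mvsub0 mvfun_sub)).
  move=> y; have := h0 y; rewrite -natr1 => /andP[? ?].
  have : 0 <= m%:R :> R by [].
  minmax_lra.
have := op_contD box_openI ch ch'; congr (op_cont _ _); apply/funext => y.
by have /andP[+ _] := h0 y; move=> /clip_nneg {2}->.
Qed.

Lemma div_cont f : div_set mvfun_sub f -> cont f.
Proof.
case=> n n0 /slice_cont hf p e e0.
have [O [oO Op h]] := hf p e e0; exists O; split=> // q /h; apply: le_trans.
rewrite -mulrnBl -[X in _ <= `|X|]mulr_natl normrM normr_nat ler_peMl //.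
by rewrite ler1n.
Qed.

Lemma slice_coord x : slice (fun p : Y => (p x)%:num).
Proof.
have : mvsub_set mvfun_sub (proj R x) by exists (Var _ x).
move=> /slice_fun01; congr (slice_set _ _); apply/funext => p; exact: projE.
Qed.

(** The point [p] may have irrational coordinates, while slopes and intercepts must be integers. The
    tent is therefore centred at a nearby lattice point, where it reaches 1, and is merely positive
    at [p]. *)
Lemma slice_tent p s d : 0 < d ->
  exists f, [/\ slice f, forall q, 0 <= f q <= 1, forall q, 0 < f q -> box p s d q,
    0 < f p & exists2 q, box p s d q & f q = 1].
Proof.
(* Each coordinate of [p] and of any point of the support is within [1 / k] of that of the centre
   [l / k], so [2 / k < d] puts the support inside the box. *)
move=> d0; pose k := (Num.truncn (2 / d)).+1.
have k0 : 0 < k%:R :> R by rewrite ltr0n.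
have kd : 2 < k%:R * d by rewrite -ltr_pdivrMr //; exact: truncnS_gt.
pose l x := Num.floor (k%:R * (p x)%:num).
have lP x : (l x)%:~R <= k%:R * (p x)%:num < (l x)%:~R + 1.
  by have := floor_itv (k%:R * (p x)%:num); rewrite intrD.
have absE (u : R) : `|u| = Num.max u (- u).
  have [u0|u0] := lerP 0 u; first by rewrite ger0_norm //; apply/esym/max_idPl; lra.
  by rewrite ltr0_norm //; apply/esym/max_idPr; lra.
pose T := foldr (fun x (g : Y -> R) q =>
   Num.min (1 - Num.max (k%:R * (q x)%:num - (l x)%:~R) (- (k%:R * (q x)%:num - (l x)%:~R)))
     (g q)) (fun=> 1).
have TP (c : R) q r : (forall x, List.In x r -> c < 1 - `|k%:R * (q x)%:num - (l x)%:~R|) ->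
    c < 1 -> c < T r q.
  elim: r => [//|x r IH] h c1 /=; rewrite lt_min IH ?andbT //; last first.
    by move=> y yr; apply: h; right.
  by have := h x (or_introl erefl); rewrite absE.
have TN q r x : List.In x r -> T r q <= 1 - `|k%:R * (q x)%:num - (l x)%:~R|.
  elim: r => [//|y r IH] /= [->|/IH h].
    by rewrite ge_min absE lexx.
  by rewrite ge_min h orbT.
have T1 q r : T r q <= 1 by elim: r => [//|y r IH] /=; rewrite ge_min IH orbT.
have sT r : slice (T r).
  elim: r => [|x r IH]; first exact: slice_one.
  have hx : slice (fun q : Y => k%:R * (q x)%:num - (l x)%:~R).
    have := slice_shift (- l x) (flg_Mn (Q := G) k (slice_coord x)).
    congr (slice_set _ _); apply/funext => q.
    by rewrite mulr_natl rmorphN.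
  apply: (flg_min (Q := G)) IH; apply: slice_sub; first exact: slice_one.
  by apply: slice_max => //; exact: slice_opp.
have dist q x : `|k%:R * (q x)%:num - (l x)%:~R| < 1 ->
    `|(q x)%:num - (p x)%:num| < d.
  have /andP[h1 h2] := lP x.
  rewrite !ltr_norml => /andP[h3 h4].
  have e : k%:R * ((q x)%:num - (p x)%:num) = k%:R * (q x)%:num - k%:R * (p x)%:num.
    by rewrite mulrBr.
  apply/andP; split; rewrite -(ltr_pM2l k0) e ?mulrN; lra.
exists (fun q => Num.max 0 (T s q)); split.
- apply: slice_max (sT s); exact: (slice_fun01 (mvsub0 mvfun_sub)).
- by move=> q; rewrite le_max lexx ge_max ler01 T1.
- move=> q; rewrite lt_max ltxx /= => Tq x xs; apply: dist.
  by have := TN q _ _ xs; lra.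
- rewrite lt_max ltxx /=; apply: TP => // x _.
  have /andP[h1 h2] := lP x; rewrite ger0_norm; lra.
have l0 x : 0 <= (l x)%:~R / k%:R :> R.
  apply: divr_ge0; last exact: ltW.
  by rewrite ler0z floor_ge0; apply: mulr_ge0.
have l1 x : (l x)%:~R / k%:R <= 1 :> R.
  have /andP[h1 _] := lP x; rewrite ler_pdivrMr // mul1r; apply: le_trans h1 _.
  by apply: ler_piMr; [exact: ltW | exact: le1].
pose q : Y := fun x => Itv01 (l0 x) (l1 x).
have qE x : k%:R * (q x)%:num = (l x)%:~R.
  by rewrite /= mulrC divfK // gt_eqF.
exists q; first by move=> x _; apply: dist; rewrite qE subrr normr0.
apply/eqP; rewrite eq_le ge_max ler01 T1 /= le_max; apply/orP; right.
rewrite leNgt; apply/negP => Tq.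
(* If the minimum were below 1 at the centre, [TP] with that very minimum as lower bound would make
   it less than itself. *)
suff : T s q < T s q by rewrite ltxx.
by apply: TP => // x _; rewrite qE subrr normr0 subr0.
Qed.

Lemma div_bump O (alpha delta : R) : box_open O -> O !=set0 ->
  0 < alpha <= 1 -> 0 < delta ->
  exists f, [/\ div_set mvfun_sub f, forall q, 0 <= f q <= alpha,
    forall q, ~ O q -> f q = 0 & exists2 q, O q & alpha - delta <= f q].
Proof.
move=> oO [p Op] /andP[a0 a1] de0.
have [s [d [d0 hd]]] := oO p Op.
have [f [sf f01 fbox _ [q hq fq]]] := slice_tent p s d0.
(* The height is the rational [m / n] just below [alpha], with [1 / n < delta]; the denominator is
   what calls for the divisible hull. *)
pose n := (Num.truncn (1 / delta)).+1.
have n0 : 0 < n%:R :> R by rewrite ltr0n.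
have nd : 1 < n%:R * delta by rewrite -ltr_pdivrMr //; exact: truncnS_gt.
pose m := Num.truncn (n%:R * alpha).
have na0 : 0 <= n%:R * alpha by rewrite mulr_ge0 ?ltW.
have /andP[m1 m2] := truncn_itv na0; rewrite -/m -natr1 in m1 m2.
have ma : m%:R / n%:R <= alpha by rewrite ler_pdivrMr // mulrC.
have ma' : alpha - delta <= m%:R / n%:R.
  by rewrite ler_pdivlMr // mulrBl ![_ * n%:R]mulrC; lra.
exists (fun y => m%:R / n%:R * f y); split.
- exists n => //; have := flg_Mn (Q := G) m sf.
  congr (slice_set _ _); apply/funext => y.
  by rewrite -[RHS]mulr_natr mulrAC divfK ?gt_eqF // mulr_natl.
- move=> y; have /andP[f0 f1] := f01 y.
  have mn0 : 0 <= m%:R / n%:R :> R by apply: divr_ge0.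
  by rewrite mulr_ge0 //= (le_trans _ ma) // ler_piMr.
- move=> y nOy; have /andP[f0 _] := f01 y.
  have [fy|fy] := ltrP 0 (f y); first by case: nOy; apply: hd; exact: fbox.
  by have -> : f y = 0 by [apply/eqP; rewrite eq_le fy]; rewrite mulr0.
- by exists q; [exact: hd | rewrite fq mulr1].
Qed.

Lemma mvfun_below (v : fun01 R Y) p : cont (\val v) -> 0 < \val v p ->
  exists (t : term void X) (n : nat), mvfun R t <> 0 /\ mv_le (mvfun R t) (v *+ n).
Proof.
move=> cv vp; have e0 : 0 < \val v p / 2 by lra.
have [O [oO Op h]] := cv p _ e0.
have [s [d [d0 hd]]] := oO p Op.
have [f [sf f01 fbox fp _]] := slice_tent p s d0.
have [t ht] := slice_clip sf.
have fE y : \val (mvfun R t) y = f y by rewrite -ht; exact: clip_id.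
(* On the support of the tent [v] is at least half of [v p], so this [n] makes [v *+ n] equal to 1
   there. *)
pose n := (Num.truncn (1 / (\val v p / 2))).+1.
have hn : 1 < n%:R * (\val v p / 2) by rewrite -ltr_pdivrMr //; exact: truncnS_gt.
exists t, n; split.
  by move=> t0; have := fE p; rewrite t0 fun01_0E => /esym f0; rewrite f0 ltxx in fp.
apply/fun01_leP => y; rewrite fE fun01_MnE le_min.
have /andP[f0 f1] := f01 y; rewrite f1 /= -[_ *+ n]mulr_natl.
have n0 : 0 < n%:R :> R by rewrite ltr0n.
have [fy|fy] := ltrP 0 (f y); last first.
  by apply: le_trans fy _; rewrite mulr_ge0 ?fun01_ge0 ?ltW.
have := h y (hd _ (fbox y fy)); rewrite ler_norml => /andP[h1 _].
have h2 : \val v p / 2 <= \val v y by lra.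
apply: le_trans f1 _; apply: ltW; apply: lt_le_trans hn _.
by apply: ler_wpM2l => //; exact: ltW.
Qed.

End Cube.

(** * The Riesz hull of a free MV-algebra *)

Lemma inj_surj_bij (A B : Type) (f : A -> B) :
  injective f -> (forall b, exists a, f a = b) -> bijective f.
Proof.
move=> fi /choice[g gK]; exists g => // a.
by apply: fi; rewrite gK.
Qed.

Lemma mv_hom_comp (A B C : mvType) (f : A -> B) (g : B -> C) :
  mv_hom f -> mv_hom g -> mv_hom (g \o f).
Proof.
by move=> [f0 fD fs] [g0 gD gs]; split=> [|a b|a] /=; rewrite ?f0 ?fD ?fs.
Qed.

Lemma teval_rsub (R : realType) (V : rieszMVType R) (S : rieszSub V) (X : Type)
    (f : X -> V) (t : term {i01 R} X) :
  (forall x, mvsub_set S (f x)) -> mvsub_set S (teval scal f t).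
Proof.
move=> hf; elim: t => /= [//||t1 IH1 t2 IH2|t1 IH1|s t1 IH1].
- exact: mvsub0.
- exact: mvsubD.
- exact: mvsub_star.
- exact: rsub_scal.
Qed.

(** The functions vanishing at [p] form a maximal ideal: if [b p > 0], some multiple [n b] is 1 at
    [p], its complement vanishes there, and the two add up to the unit. An element lying in all
    these ideals is zero. *)
Lemma fun01_semisimple (R : realType) (Y : Type) (F : mvType)
    (h : F -> fun01 R Y) : mv_embedding h -> mv_semisimple F.
Proof.
move=> [hh hinj]; apply/seteqP; split=> [a ha|_ -> I [hI _ _]]; last exact: mv_ideal0.
apply: hinj; rewrite (mv_hom0 hh); apply: fun01_eqP => p; rewrite fun01_0E.
apply: (ha [set b | \val (h b) p = 0]).
have h1 : \val (h (mv_one F)) p = 1.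
  by rewrite (mv_hom_star hh) (mv_hom0 hh) fun01_1E.
split.
- split.
  + by exists 0; rewrite /= (mv_hom0 hh).
  + move=> b c /(mv_hom_le hh)/fun01_leP/(_ p) bc c0.
    have {}c0 : \val (h c) p = 0 := c0; rewrite c0 in bc.
    by apply/eqP; rewrite eq_le bc fun01_ge0.
  + move=> b c b0 c0; have {}b0 : \val (h b) p = 0 := b0.
    have {}c0 : \val (h c) p = 0 := c0.
    rewrite -[_ (b + c)]/(\val (h (b + c)) p = 0) (mv_homD hh) fun01_DE b0 c0 addr0.
    by apply/min_idPr; exact: ler01.
- move=> /seteqP[_ /(_ (mv_one F) I)] e.
  have {}e : \val (h (mv_one F)) p = 0 := e.
  by move/eqP: e; rewrite h1 oner_eq0.
move=> J hJ JT sJ; apply/seteqP; split=> // b Jb; apply: contrapT => bp.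
apply: JT; apply/seteqP; split=> // c _; apply: (mv_ideal_le hJ (mv_lex1 c)).
have b0 : 0 < \val (h b) p.
  by rewrite lt_neqAle fun01_ge0 andbT eq_sym; exact/eqP.
pose n := (Num.truncn (1 / \val (h b) p)).+1.
have hn : 1 < n%:R * \val (h b) p by rewrite -ltr_pdivrMr //; exact: truncnS_gt.
rewrite -(mv_addN (b *+ n)); apply: (mv_idealD hJ (mv_idealMn hJ _ Jb)).
apply: sJ; rewrite -[_ (star _)]/(\val (h (star (b *+ n))) p = 0) (mv_hom_star hh).
rewrite fun01_starE (mv_homMn hh) fun01_MnE.
by rewrite -[_ *+ n]mulr_natl (min_idPl (ltW hn)) subrr.
Qed.

Section LGroupEmbedding.
Variables (G D : lgroupType) (u : strongUnit G) (ud : strongUnit D) (k : G -> D).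
Hypothesis hk : lgroup_embedding k.
Hypothesis hu : su_val ud = k (su_val u).

Lemma lgroup_emb0 : k 0 = 0.
Proof.
by case: hk => _ kD _ _; apply: (@addrI _ (k 0)); rewrite -kD !addr0.
Qed.

Lemma lgroup_emb_le x y : x <= y -> k x <= k y.
Proof.
by case: hk => _ _ km _ /lg_meet_l <-; rewrite km; exact: lg_meetr.
Qed.

Lemma gamma_map_subproof (x : gamma u) : 0 <= k (\val x) <= su_val ud.
Proof.
rewrite hu -lgroup_emb0; apply/andP.
by split; apply: lgroup_emb_le; [exact: gamma_ge0 | exact: gamma_le].
Qed.

Definition gamma_map (x : gamma u) : gamma ud := Gamma (gamma_map_subproof x).

Lemma gamma_map_embedding : mv_embedding gamma_map.
Proof.
case: (hk) => ki kD km _; split.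
  split=> [|x y|x]; apply: val_inj => /=.
  - exact: lgroup_emb0.
  - by rewrite km kD hu.
  - by apply: (@addIr _ (k (\val x))); rewrite -kD !subrK hu.
by move=> x y /(congr1 \val) /= /ki /val_inj.
Qed.
End LGroupEmbedding.

Section Free.
Variables (R : realType) (X : Type).
Local Notation Y := (X -> {i01 R}).

Section Pair.
Variables (F : mvType) (i : X -> F) (V : rieszMVType R) (j : X -> V).
Hypotheses (hF : free_mv i) (hV : free_rmv j).

Lemma free_essential (iota : F -> V) :
  mv_hom iota -> (forall x, iota (i x) = j x) -> mv_essential iota.
Proof.
move=> hi ij; have [h [[hh hinj] ht]] := free_mv_embed R hF.
have [g [[gh gs] ginj gt]] := free_rmv_embed hV.
(* Read as functions on the same cube, [iota] is the inclusion of MV-term functions among Riesz term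
   functions. *)
have gi t : g (iota (teval (@void_act F) i t)) = mvfun R t.
  rewrite -[LHS]/((g \o iota) _).
  rewrite (teval_hom (actB := @void_act _) _ _ (mv_hom_comp hi gh)) => [|[]].
  congr teval; apply/funext => x /=; rewrite ij -[j x]/(teval scal j (Var _ x)) gt.
  by [].
split; first split=> // a b e.
  have [t ta] := free_mv_gen hF a; have [t' tb] := free_mv_gen hF b.
  by apply: hinj; rewrite ta tb !ht -!gi -ta -tb e.
move=> b [_ b0].
have [p bp] : exists p, 0 < \val (g b) p.
  apply: contrapT => np; apply: b0; apply: ginj; rewrite (mv_hom0 gh).
  apply/esym/fun01_eqP => p; apply/eqP; rewrite eq_le fun01_ge0 andbT fun01_0E leNgt.
  by apply/negP => bp; apply: np; exists p.
have cb : op_cont (@box_open R X) (\val (g b)).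
  by have [t ->] := free_rmv_gen hV b; rewrite gt; exact: cont_rmvfun.
have [t [n [t0 tle]]] := mvfun_below cb bp.
exists (teval (@void_act F) i t), n; split.
  split; first exact: mv_le0x.
  by move=> e; apply: t0; rewrite -ht -e (mv_hom0 hh).
by apply: (mv_hom_le_inj gh ginj); rewrite gi (mv_homMn gh).
Qed.

Lemma free_hull (D : rieszHullData R F) : riesz_isomorphic (riesz_hull D) V.
Proof.
have [k_emb _ _] := rh_k_hull D.
pose K := gamma_map k_emb (rh_udE D).
have [K_hom K_inj] : mv_embedding K := gamma_map_embedding k_emb (rh_udE D).
have [phi_hom phi_bij] := rh_phi_iso D.
have [[e_hom e_inj] _ _] := rh_e_completion D.
pose psi := rh_e D \o (K \o rh_phi D).
have psi_hom : mv_hom psi := mv_hom_comp (mv_hom_comp phi_hom K_hom) e_hom.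
have psi_inj : injective psi.
  by move=> a b /e_inj /K_inj /(bij_inj phi_bij).
have imageE c : @rh_image R F D c <-> exists a, c = psi a.
  split=> [[a [b [hb ->]]]|[a ->]]; last by exists a, (K (rh_phi D a)).
  by exists a; congr (rh_e D); apply: val_inj.
have [iota [[iota_hom iota_i] _]] := hF j.
have [_ ess] := free_essential iota_hom iota_i.
have [H [[[H_hom H_scal] H_j] _]] := hV (psi \o i).
have H_iota : H \o iota = psi.
  have [k [_ kU]] := hF (psi \o i).
  rewrite -(kU psi) // -(kU (H \o iota)) //; split; first exact: mv_hom_comp.
  by move=> x; rewrite /= iota_i H_j.
have H_inj : injective H.
  apply: (mv_hom_inj H_hom) => v v0; apply: contrapT => vn0.
  have [|a [n [[_ a0] an]]] := ess v.
    by split; [exact: mv_le0x | move=> e; apply: vn0].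
  apply: a0; apply: psi_inj; rewrite (mv_hom0 psi_hom) -H_iota; apply/esym/mv_le0.
  by have := mv_hom_le H_hom an; rewrite (mv_homMn H_hom) v0 mul0rn.
have H_gen v : rgen_set (@rh_image R F D) (H v).
  have [t ->] := free_rmv_gen hV v.
  rewrite (teval_hom _ _ H_hom H_scal); apply: (@teval_rsub _ _ (rgen (@rh_image R F D))).
  move=> x S hS /=; rewrite H_j; apply: hS; apply/imageE.
  by exists (i x).
have H_surj c : rgen_set (@rh_image R F D) c -> exists v, H v = c.
  have H0 : range H 0 by exists 0 => //; exact: mv_hom0.
  have HD a b : range H a -> range H b -> range H (a + b).
    by move=> [v _ <-] [w _ <-]; exists (v + w) => //; exact: mv_homD.
  have Hs a : range H a -> range H (star a).
    by move=> [v _ <-]; exists (star v) => //; exact: mv_hom_star.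
  have Hc r a : range H a -> range H (scal r a).
    by move=> [v _ <-]; exists (scal r v).
  move=> /(_ (RieszSub (rsub_mv := MVSub H0 HD Hs) Hc)) [].
    by move=> _ /imageE[a ->]; exists (iota a) => //; rewrite -H_iota.
  by move=> v _ <-; exists v.
(* The map sought leaves the hull, so it is the inverse of [H] on its range; injectivity of [H]
   transfers each operation. *)
have /choice[f fP] (x : riesz_hull D) : exists v, H v = \val x.
  by apply: H_surj; exact: (mvsub_valP x).
exists f; split.
  split; first split.
  - by apply: H_inj; rewrite fP (mv_hom0 H_hom).
  - by move=> x y; apply: H_inj; rewrite fP (mv_homD H_hom) !fP.
  - by move=> x; apply: H_inj; rewrite fP (mv_hom_star H_hom) fP.
  - by move=> r x; apply: H_inj; rewrite fP H_scal fP.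
apply: inj_surj_bij => [x y e|v].
  by apply: val_inj; rewrite -!fP e.
pose x : riesz_hull D := @mvsub_mk _ (rgen (@rh_image R F D)) (H v) (H_gen v).
by exists x; apply: H_inj; rewrite fP.
Qed.

End Pair.

(** This keeps the statement about all hull data from being vacuous. The model consists of the slice
    group of the MV-term functions, its fractions, and the completion over the product topology of
    the cube. *)
Lemma free_hull_data (F : mvType) (i : X -> F) :
  free_mv i -> inhabited (rieszHullData R F).
Proof.
move=> hF; have [h [[hh hinj] ht]] := free_mv_embed R hF.
pose A := mvfun_sub R X.
have hA a : mvsub_set A (h a).
  by have [t ->] := free_mv_gen hF a; rewrite ht; exists t.
have /choice[phi phiP] a : exists g, gamma_fun (Q := slice_group A) g = h a.
  by apply: gamma_fun_surj; exact: (slice_fun01 (hA a)).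
have phi_iso : mv_iso phi.
  have [g0 gD gs] := gamma_fun_hom (slice_group A).
  have gi := @gamma_fun_inj _ _ (slice_group A).
  split.
    split=> [|a b|a]; apply: gi; rewrite ?g0 ?gD ?gs !phiP.
    - exact: mv_hom0.
    - exact: mv_homD.
    - exact: mv_hom_star.
  apply: inj_surj_bij => [a b e|g]; first by apply: hinj; rewrite -!phiP e.
  have [t tg] := gamma_slice_mem g.
  by exists (teval (@void_act F) i t); apply: gi; rewrite phiP ht tg.
have unitE : su_val (flgroup_unit (div_group A))
    = slice_incl (su_val (flgroup_unit (slice_group A))).
  exact: flg_eqP.
have g_emb : mv_embedding (@gamma_fun _ _ (div_group A)).
  by split; [exact: gamma_fun_hom | exact: gamma_fun_inj].
have g_cont (d : gamma (flgroup_unit (div_group A))) :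
    op_cont (@box_open R X) (\val (gamma_fun d)).
  exact: (div_cont (flg_valP (\val d))).
have g_bump O (al de : R) : box_open O -> O !=set0 -> 0 < al <= 1 -> 0 < de ->
  exists d : gamma (flgroup_unit (div_group A)),
    [/\ forall y, \val (gamma_fun d) y <= al, forall y, ~ O y -> \val (gamma_fun d) y = 0
    & exists2 p, O p & al - de <= \val (gamma_fun d) p].
  move=> oO O0 al01 de0; have [f [fd f01 fO fp]] := div_bump oO O0 al01 de0.
  have f1 y : 0 <= f y <= 1.
    have /andP[f0 fa] := f01 y; have /andP[_ a1] := al01.
    by rewrite f0 (le_trans fa a1).
  have [d dE] := @gamma_fun_surj _ _ (div_group A) (fun01_mk f1) fd.
  exists d; rewrite dE; split=> // y.
  by have /andP[] := f01 y.
have dm := to_completion_dm (@box_openT R X) (@box_openI R X) g_emb g_cont g_bump.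
constructor.
exact: (@RieszHullData R F (fun01_semisimple (conj hh hinj)) _ _ phi phi_iso
  _ _ (slice_divisible_hull A) _ unitE _ _ dm).
Qed.

Definition rmvfun_set : set (fun01 R Y) :=
  [set a | exists t : term {i01 R} X, a = rmvfun t].

Lemma rmvfun_set0 : rmvfun_set 0.
Proof. by exists Zero. Qed.
Lemma rmvfun_setD a b : rmvfun_set a -> rmvfun_set b -> rmvfun_set (a + b).
Proof. by move=> [t ->] [t' ->]; exists (Plus t t'). Qed.
Lemma rmvfun_set_star a : rmvfun_set a ->
  rmvfun_set (star a).
Proof. by move=> [t ->]; exists (Star t). Qed.
Lemma rmvfun_set_scal s a : rmvfun_set a ->
  rmvfun_set (scal s a).
Proof. by move=> [t ->]; exists (Scale s t). Qed.

Definition rmvfun_sub : rieszSub (fun01 R Y) :=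
  RieszSub (rsub_mv := MVSub rmvfun_set0 rmvfun_setD rmvfun_set_star) rmvfun_set_scal.

(** Inside the Riesz MV-algebra of all term functions on the cube, those given by scalar-free terms
    form the required subalgebra; both are free by the criteria applied to the inclusions into all
    functions. *)
Lemma free_realization :
  exists (V : rieszMVType R) (S : mvSub V) (i : X -> mvsub_sort S),
     free_mv i /\ free_rmv (fun x => \val (i x)) /\
     mv_essential (\val : mvsub_sort S -> V).
Proof.
pose V : rieszMVType R := rsub_sort rmvfun_sub.
have val_hom : riesz_hom (\val : V -> fun01 R Y) by [].
pose P : set V := [set v | exists t : term void X, \val v = mvfun R t].
have P0 : P 0 by exists Zero.
have PD a b : P a -> P b -> P (a + b).
  by move=> [t ta] [t' tb]; exists (Plus t t');
    rewrite /mvfun /= -/(mvfun R t) -ta -/(mvfun R t') -tb.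
have Ps a : P a -> P (star a).
  by move=> [t ta]; exists (Star t); rewrite /mvfun /= -/(mvfun R t) -ta.
pose S := MVSub P0 PD Ps.
have projV x : mvsub_set rmvfun_sub (proj R x) by exists (Var _ x).
pose j x : V := @mvsub_mk _ rmvfun_sub _ (projV x).
have jP x : mvsub_set S (j x) by exists (Var _ x).
pose i x : mvsub_sort S := mvsub_mk (jP x).
have hi : free_mv i.
  have hh : mv_hom (\val \o \val : mvsub_sort S -> fun01 R Y).
    exact: mv_hom_comp (@mvsub_val_hom V S) val_hom.1.
  apply: (free_mv_crit hh) => // a.
  have [t ta] := mvsub_valP a; exists t; apply: val_inj; apply: val_inj.
  rewrite ta -[RHS]/((\val \o \val : mvsub_sort S -> fun01 R Y) _).
  by rewrite (teval_hom (actB := @void_act _) _ _ hh) => [|[]].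
have hj : free_rmv j.
  apply: (free_rmv_crit val_hom) => // a.
  have [t ta] := mvsub_valP a; exists t; apply: val_inj.
  by rewrite [LHS]ta (teval_hom _ _ val_hom.1 val_hom.2).
exists V, S, i; split=> //; split; first exact: hj.
exact: (free_essential hi hj).
Qed.

End Free.

Theorem proposition4p1 (R : realType) (X : Type) (hX : inhabited X) :
  (forall (F : mvType) (i : X -> F) (V : rieszMVType R) (j : X -> V),
     free_mv i -> free_rmv j ->
     inhabited (rieszHullData R F) /\
     (forall D : rieszHullData R F, riesz_isomorphic (riesz_hull D) V) /\
     (exists iota : F -> V, mv_essential iota)) /\
  (exists (V : rieszMVType R) (S : mvSub V) (i : X -> mvsub_sort S),
     free_mv i /\ free_rmv (fun x => \val (i x)) /\
     mv_essential (\val : mvsub_sort S -> V)).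
Proof.
split; last exact: free_realization.
move=> F i V j hF hV; split; first exact: free_hull_data hF.
split; first exact: free_hull hF hV.
have [iota [[iota_hom iota_i] _]] := hF V j.
by exists iota; exact: (free_essential hF hV).
Qed.
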